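(* Let $\alpha\in\mathbb{R}\setminus\pi\mathbb{Z}$. Suppose $f\in e_{-\alpha}L^1(\mathbf{T}^n_\alpha)$ and $$\sum_{m\in\mathbb{Z}^n}|\mathcal{F}_\alpha(f)(m)|<\infty.$$ Then $$f(x)=\sum_{m\in\mathbb{Z}^n}\mathcal{F}_\alpha(f)(m)K_{-\alpha}(m,x)\quad\text{for a.e. }x\in\mathbf{T}^n_\alpha,$$ and therefore $f$ is almost everywhere equal to a continuous function.
   Context: Let $n\ge 1$ and $\alpha\in\mathbb{R}\setminus\pi\mathbb{Z}$. The fractional torus $\mathbf{T}^n_\alpha$ is the cube of side $|\sin\alpha|$ with opposite sides identified, represented by $[-|\sin\alpha|/2,|\sin\alpha|/2]^n$; functions on $\mathbf{T}^n_\alpha$ are functions on $\mathbb{R}^n$ that are $|\sin\alpha|$-periodic in each coordinate, equivalently functions on this cube, and integrals over $\mathbf{T}^n_\alpha$ are taken over this cube with Lebesgue measure. Put $e_\alpha(x)=e^{\pi i|x|^2\cot\alpha}$, $e_{-\alpha}(x)=e^{-\pi i|x|^2\cot\alpha}$. $e_{-\alpha}L^1(\mathbf{T}^n_\alpha)$ is the space of functions $f=e_{-\alpha}g$ on the cube with $g\in L^1(\mathbf{T}^n_\alpha)$. Put $A_\alpha=\sqrt{1-i\cot\alpha}$ (principal branch), $e_\alpha(m,x)=e^{-2\pi i(m\cdot x)\csc\alpha}$ and $K_\alpha(m,x)=A_\alpha^n e_\alpha(x)e_\alpha(m,x)e_\alpha(m)$; $K_{-\alpha}$ is obtained by replacing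 $\alpha$ by $-\alpha$. The $m$-th fractional Fourier coefficient of order $\alpha$ is $\mathcal{F}_\alpha(f)(m)=\int_{\mathbf{T}^n_\alpha}f(x)K_\alpha(m,x)\,dx$, $m\in\mathbb{Z}^n$. *)

(* Defs.v *)
From HB Require Import structures.
From mathcomp Require Import all_boot all_order all_algebra.
From mathcomp Require Import finmap complex.
From mathcomp Require Import all_classical all_reals all_analysis.
From mathcomp Require Import summability.

Set Implicit Arguments.
Unset Strict Implicit.
Unset Printing Implicit Defensive.

Import Order.TTheory GRing.Theory Num.Theory.
Import numFieldNormedType.Exports.

Local Open Scope classical_set_scope.
Local Open Scope ring_scope.
Local Open Scope complex_scope.

(* R^n is 'rV[R]_n; its sigma-algebra is the one generated by the coordinates,
   i.e. the Borel sigma-algebra. *)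
Section measurable_rV.
Context {R : realType} (n : nat).

Definition rV_coord (i : 'I_n) (x : 'rV[R]_n) : measurableTypeR R := x ord0 i.

Let rV_set0 : g_sigma_preimage rV_coord set0.
Proof. exact: sigma_algebra0. Qed.

Let rV_setC A : g_sigma_preimage rV_coord A -> g_sigma_preimage rV_coord (~` A).
Proof. exact: sigma_algebraC. Qed.

Let rV_bigcup (F : (set 'rV[R]_n)^nat) :
  (forall i, g_sigma_preimage rV_coord (F i)) ->
  g_sigma_preimage rV_coord (\bigcup_i (F i)).
Proof. exact: sigma_algebra_bigcup. Qed.

HB.instance Definition _ :=
  @isMeasurable.Build default_measure_display
    'rV[R]_n (g_sigma_preimage rV_coord) rV_set0 rV_setC rV_bigcup.

Lemma measurable_rV_coord (i : 'I_n) : measurable_fun [set: 'rV[R]_n] (rV_coord i).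
Proof.
move=> _ Y mY; rewrite setTI; apply: sub_sigma_algebra => /=.
rewrite -bigcup_seq/=; exists i => /=; first by rewrite mem_index_enum.
by exists Y => //; rewrite setTI.
Qed.

Lemma measurable_fun_rV d (T : measurableType d) (f : T -> 'rV[R]_n) :
  (forall i, measurable_fun [set: T] (rV_coord i \o f)) ->
  measurable_fun [set: T] f.
Proof.
move=> mf _ A mA.
suff: g_sigma_preimage (fun i => rV_coord i \o f) `<=` @measurable d T.
  by rewrite g_sigma_preimage_comp; apply; exists A.
apply: smallest_sub; first exact: sigma_algebra_measurable.
rewrite -bigcup_seq/=; apply: bigcup_sub => i _.
by move=> B [C mC <-]; exact: mf.
Qed.

End measurable_rV.

Section lebesgue_rV.
Context {R : realType}.

Local Notation borel_rV n := [the measurableType _ of 'rV[R]_n].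

Definition rV_cons n (p : measurableTypeR R * 'rV[R]_n) : 'rV[R]_n.+1 :=
  row_mx (p.1 : R)%:M p.2.

Definition rV_uncons n (x : 'rV[R]_n.+1) : measurableTypeR R * 'rV[R]_n :=
  (x ord0 ord0, \row_i x ord0 (lift ord0 i)).

Lemma rV_cons0 n p : @rV_cons n p ord0 ord0 = p.1.
Proof.
rewrite /rV_cons (_ : ord0 = lshift n (ord0 : 'I_1) :> 'I_n.+1).
  by apply: etrans (row_mxEl _ _ _ _) _; rewrite mxE eqxx mulr1n.
exact/val_inj.
Qed.

Lemma rV_consS n p i : @rV_cons n p ord0 (lift ord0 i) = p.2 ord0 i.
Proof.
rewrite /rV_cons (_ : lift ord0 i = rshift 1 i :> 'I_n.+1).
  exact: row_mxEr.
exact/val_inj.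
Qed.

Lemma rV_consK n : cancel (@rV_cons n) (@rV_uncons n).
Proof.
move=> [a x]; rewrite /rV_uncons rV_cons0; congr pair.
by apply/rowP => i; rewrite mxE rV_consS.
Qed.

Lemma rV_unconsK n : cancel (@rV_uncons n) (@rV_cons n).
Proof.
move=> x; apply/rowP => i.
have [j ->|->] := unliftP ord0 i; first by rewrite rV_consS mxE.
by rewrite rV_cons0.
Qed.

Lemma measurable_rV_cons n : measurable_fun setT (@rV_cons n).
Proof.
apply: measurable_fun_rV => i; have [j ->|->] := unliftP ord0 i.
  rewrite (_ : _ \o _ = rV_coord j \o snd).
    by apply: measurableT_comp => //; exact: measurable_rV_coord.
  by apply/funext => p; exact: rV_consS.
rewrite (_ : _ \o _ = fst) //; apply/funext => p; exact: rV_cons0.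
Qed.

Lemma measurable_rV_uncons n : measurable_fun setT (@rV_uncons n).
Proof.
apply/measurable_fun_pairP; split; first exact: (measurable_rV_coord ord0).
apply: measurable_fun_rV => i.
rewrite (_ : _ \o _ = rV_coord (lift ord0 i)); first exact: measurable_rV_coord.
by apply/funext => x; rewrite /rV_coord /= mxE.
Qed.

Section step.
Variables (n : nat) (mu : {sigma_finite_measure set (borel_rV n) -> \bar R}).

Definition lebesgue_rV_step : set 'rV[R]_n.+1 -> \bar R :=
  pushforward (@lebesgue_measure R \x mu)%E (@rV_cons n).

Let step0 : lebesgue_rV_step set0 = 0%E.
Proof. by rewrite /lebesgue_rV_step /pushforward preimage_set0 measure0. Qed.

Let step_ge0 A : (0 <= lebesgue_rV_step A)%E.
Proof. by rewrite /lebesgue_rV_step /pushforward; exact: measure_ge0. Qed.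

Let step_sigma_additive : semi_sigma_additive lebesgue_rV_step.
Proof.
move=> F mF tF mUF; rewrite /lebesgue_rV_step /pushforward preimage_bigcup.
apply: measure_semi_sigma_additive.
- by move=> k; rewrite -[X in measurable X]setTI; exact: measurable_rV_cons.
- apply/trivIsetP => /= i j _ _ ij; rewrite -preimage_setI.
  by move/trivIsetP : tF => /(_ _ _ _ _ ij) ->//; rewrite preimage_set0.
- rewrite -preimage_bigcup -[X in measurable X]setTI.
  exact: measurable_rV_cons.
Qed.

HB.instance Definition _ := isMeasure.Build _ _ _
  lebesgue_rV_step step0 step_ge0 step_sigma_additive.

Let step_sigma_finite : sigma_finite setT lebesgue_rV_step.
Proof.
have /sigma_finiteP[F [TF ndF Foo]] := sigma_finiteT (@lebesgue_measure R).
have /sigma_finiteP[G [TG ndG Goo]] := sigma_finiteT mu.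
exists (fun k => @rV_uncons n @^-1` (F k `*` G k)).
  rewrite -preimage_bigcup (_ : \bigcup_k (F k `*` G k) = setT).
    by rewrite preimage_setT.
  rewrite -setXTT TF TG predeqE => -[x y]; split.
    by move=> [k _ []/= ? ?]; split; exists k.
  move=> [/= [k _ Fkx] [l _ Gly]]; exists (maxn k l) => //; split.
  - by move: x Fkx; exact/subsetPset/ndF/leq_maxl.
  - by move: y Gly; exact/subsetPset/ndG/leq_maxr.
move=> k; have [mF Fk] := Foo k; have [mG Gk] := Goo k; split.
  rewrite -[X in measurable X]setTI; apply: measurable_rV_uncons => //.
  exact: measurableX.
rewrite /lebesgue_rV_step /pushforward -comp_preimage.
rewrite (_ : _ \o _ = id); last by apply/funext; exact: rV_consK.
by rewrite preimage_id product_measure1E// lte_mul_pinfty// ge0_fin_numE.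
Qed.

HB.instance Definition _ := Measure_isSigmaFinite.Build _ _ _
  lebesgue_rV_step step_sigma_finite.

End step.

(* n-dimensional Lebesgue measure, as the n-fold product of the
   one-dimensional one; R^0 is a point of mass 1. *)
Fixpoint lebesgue_rV n : {sigma_finite_measure set (borel_rV n) -> \bar R} :=
  if n is n'.+1 then lebesgue_rV_step (lebesgue_rV n')
  else \d_(0 : 'rV[R]_0).

Lemma lebesgue_rV_box n (a b : 'rV[R]_n) :
  (forall i, a ord0 i <= b ord0 i) ->
  lebesgue_rV n [set x | forall i, a ord0 i <= x ord0 i <= b ord0 i] =
  (\prod_i (b ord0 i - a ord0 i))%:E.
Proof.
elim: n a b => [|n IHn] a b ab.
  rewrite big_ord0 /= diracE mem_set// => -[]//.
pose tl (x : 'rV[R]_n.+1) := (rV_uncons x).2.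
rewrite [LHS]/= /lebesgue_rV_step /pushforward.
rewrite (_ : _ @^-1` _ = `[a ord0 ord0, b ord0 ord0]%classic `*`
  [set x : 'rV[R]_n | forall i, tl a ord0 i <= x ord0 i <= tl b ord0 i]); last first.
  apply/seteqP; split => [[u x]/= H|[u x]/= [H1 H2] i].
    split; first by rewrite in_itv/=; have := H ord0; rewrite rV_cons0.
    by move=> i; have := H (lift ord0 i); rewrite rV_consS /tl/= !mxE.
  have [j ->|->] := unliftP ord0 i; last by move: H1; rewrite rV_cons0 in_itv.
  by have := H2 j; rewrite rV_consS /tl/= !mxE.
rewrite product_measure1E//.
- rewrite [X in (X * _)%E](lebesgue_measure_itv `[a ord0 ord0, b ord0 ord0])/= lte_fin IHn; last by move=> i; rewrite /tl/= !mxE.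
  rewrite big_ord_recl/=.
  rewrite (eq_bigr (fun i => b ord0 (lift ord0 i) - a ord0 (lift ord0 i))); last first.
    by move=> i _; rewrite /tl /= !mxE.
  have [ab0|] := ltP; first by rewrite -EFinM.
  move=> ba; rewrite mul0e (_ : b _ _ = a ord0 ord0) ?subrr ?mul0r//.
  by apply/eqP; rewrite eq_le ba ab.
- rewrite (_ : [set _ | _] = \bigcap_(i in [set: 'I_n])
    (rV_coord i @^-1` `[tl a ord0 i, tl b ord0 i]%classic)).
    apply: fin_bigcap_measurable => // i _.
    rewrite -[X in measurable X]setTI; exact: measurable_rV_coord.
  apply/seteqP; split => x /= H i; first by move=> _; rewrite /= in_itv /=; exact: H.
  by have := H i I; rewrite /= in_itv.
Qed.

End lebesgue_rV.

Section fractional_fourier.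
Context {R : realType}.

Definition cot (a : R) : R := cos a / sin a.
Definition csc (a : R) : R := (sin a)^-1.

(* e^{it} for real t *)
Definition expi (t : R) : R[i] := cos t +i* sin t.

Definition dotp n (x y : 'rV[R]_n) : R := \sum_i x ord0 i * y ord0 i.

(* e_alpha(x) *)
Definition chirp n (a : R) (x : 'rV[R]_n) : R[i] :=
  expi (pi * dotp x x * cot a).

(* e_alpha(m, x) *)
Definition frac_char n (a : R) (m x : 'rV[R]_n) : R[i] :=
  expi (- (2 * pi * dotp m x * csc a)).

(* sqrtc has nonnegative real part, hence is the principal branch (unlike the
   sqrtC of numClosedFieldType, whose imaginary part is nonnegative). *)
Definition frac_amp (a : R) : R[i] := sqrtc (1 -i* cot a).

Definition int_rV n (m : 'rV[int]_n) : 'rV[R]_n := map_mx intr m.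

(* K_alpha(m, x) *)
Definition frac_kernel n (a : R) (m : 'rV[int]_n) (x : 'rV[R]_n) : R[i] :=
  frac_amp a ^+ n * chirp a x * frac_char a (int_rV m) x * chirp a (int_rV m).

(* Fundamental domain of the torus T^n_alpha. *)
Definition frac_cube n (a : R) : set 'rV[R]_n :=
  [set x | forall i, - (`|sin a| / 2) <= x ord0 i <= `|sin a| / 2].

Definition cintegral n (D : set 'rV[R]_n) (g : 'rV[R]_n -> R[i]) : R[i] :=
  (\int[lebesgue_rV n]_(x in D) complex.Re (g x)) +i*
  (\int[lebesgue_rV n]_(x in D) complex.Im (g x)).

(* A Lebesgue-integrable function on the cube is one that agrees almost
   everywhere there with a Borel function of finite L^1 norm. *)
Definition frac_L1 n (a : R) (g : 'rV[R]_n -> R[i]) : Prop :=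
  exists g0 : 'rV[R]_n -> R[i],
    [/\ measurable_fun (frac_cube a) (fun x => complex.Re (g0 x)),
        measurable_fun (frac_cube a) (fun x => complex.Im (g0 x)),
        (\int[lebesgue_rV n]_(x in frac_cube a) (Normc.normc (g0 x))%:E
           < +oo)%E &
        g = g0 %[ae lebesgue_rV n in frac_cube a]].

(* e_{-alpha} L^1(T^n_alpha) *)
Definition chirp_L1 n (a : R) (f : 'rV[R]_n -> R[i]) : Prop :=
  exists2 g : 'rV[R]_n -> R[i], frac_L1 a g &
    forall x, frac_cube a x -> f x = chirp (- a) x * g x.

Definition frac_fourier n (a : R) (f : 'rV[R]_n -> R[i]) (m : 'rV[int]_n) :
  R[i] := cintegral (frac_cube a) (fun x => f x * frac_kernel a m x).

(* Unconditional convergence: the finite partial sums converge along the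
   directed set of finite index sets. *)
Definition csums_to (I : choiceType) (u : I -> R[i]) (l : R[i]) : Prop :=
  partial_sum (u : I -> R[i]^o) @ totally --> (l : R[i]^o).

(* Continuous function on T^n_alpha, as a periodic function on R^n. *)
Definition continuous_torus n (a : R) (h : 'rV[R]_n -> R[i]) : Prop :=
  continuous (h : 'rV[R]_n -> R[i]^o) /\
  forall x i, h (x + `|sin a| *: delta_mx ord0 i) = h x.

End fractional_fourier.

(* Main.v *)
Require Import Defs.
From mathcomp Require Import all_boot all_order all_algebra.
From mathcomp Require Import finmap complex.
From mathcomp Require Import all_classical all_reals all_analysis.
From mathcomp Require Import summability measurable_realfun.
From mathcomp Require Import ring lra.

Set Implicit Arguments.
Unset Strict Implicit.
Unset Printing Implicit Defensive.

Import Order.TTheory GRing.Theory Num.Theory.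
Import numFieldNormedType.Exports.

Local Open Scope classical_set_scope.
Local Open Scope ring_scope.

(** Multiplying by the chirp [e_alpha] turns the fractional Fourier integral of
    [f = e_{-alpha} g] into the usual Fourier integral of [g] on a torus of side
    [s = |sin alpha|], with frequencies [w m] for [w = csc alpha] and so
    [|w| s = 1].  The statement is then the classical one: an integrable [g]
    with summable Fourier coefficients is almost everywhere the sum [S] of its
    Fourier series, a uniform limit of trigonometric polynomials and therefore
    continuous and periodic.

    Since [S] converges uniformly, it has the same Fourier coefficients as [g]
    ([series_coef], from the orthogonality of the characters), so everything
    rests on uniqueness: an integrable [u] orthogonal to all characters vanishes
    almost everywhere ([trig_orth_ae0]).  Consider the bounded functions [f] for
    which [u f] integrates to zero against every character, and call multiplier a
    bounded function that takes such [f] to such functions.  Multipliers form an algebra closed under bounded almost everywhere limits,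
    and contain the characters themselves.  A trigonometric polynomial in one
    coordinate [x_i] separates [x_i < b] from [x_i > b] inside the cube
    ([half_space_fun]), and the polynomials [(1 - y^k)^(2^k)] sharpen it into the
    indicator of a half-space.  The sets whose indicator is a multiplier form a
    sigma-algebra, so it contains all Borel sets, the integral of [u] over every
    Borel set is zero, and [u] vanishes almost everywhere.

    Two points are specific to the fractional setting.  The function [f] only
    agrees almost everywhere with a Borel function, so its coefficients are
    integrals of functions that may fail to be measurable; [eq_integral_ae] says
    that the integral ignores null sets even then.  And the chirp in [x] is not
    periodic, but [|x|^2] takes equal values at opposite faces of the centred
    cube, so the restriction of the chirp to the cube has a continuous periodic
    extension, written here with [arccos (cos t)], the distance from [t] to the
    multiples of [2 pi] ([torus_chirp_angle]). *)

(** * Unordered sums dominated by a summable family *)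

#[local] Existing Instance totally_filter.

Section unordered_sums.
Context {R : realType} {I : choiceType}.
Implicit Types (a b : I -> R) (A B : {fset I}).
Local Open Scope fset_scope.

Lemma partial_sumE (V : zmodType) (b : I -> V) A :
  partial_sum b A = \sum_(i <- A) b i.
Proof. by rewrite /partial_sum big_seq_fsetE. Qed.

(** Beyond a finite set whose sum is within [e] of the supremum, no finite sum can
    exceed [e]. *)
Lemma esum_tail a : (forall i, 0 <= a i) ->
  (\esum_(i in [set: I]) (a i)%:E < +oo)%E ->
  forall e, 0 < e -> exists A, forall B, [disjoint A & B] ->
    \sum_(i <- B) a i < e.
Proof.
move=> a0 sa e e0.
have s_fin : (\esum_(i in [set: I]) (a i)%:E)%E \is a fin_num.
  by rewrite ge0_fin_numE//; apply: esum_ge0 => i _; rewrite lee_fin.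
have [_ [X [finX _]] <- ltX] :
    exists2 x, [set (\sum_(x \in A) (a x)%:E)%E | A in fsets [set: I]]%classic x &
      (\esum_(i in [set: I]) (a i)%:E - e%:E < x)%E.
  exact: ub_ereal_sup_adherent.
exists (fset_set X) => B XB.
have le_s (C : {fset I}) : ((\sum_(i <- C) a i)%:E <= \esum_(i in [set: I]) (a i)%:E)%E.
  apply: esum_ge; exists [set` C]; first by split => //; exact: finite_fset.
  by rewrite fsbig_finite//= ?set_fsetK ?sumEFin//; exact: finite_fset.
have := le_s (fset_set X `|` B).
have -> : \sum_(i <- fset_set X `|` B) a i =
    (\sum_(i <- fset_set X) a i + \sum_(i <- B) a i)%R.
  rewrite -big_cat; apply: perm_big; apply: uniq_perm; first exact: fset_uniq.
    rewrite cat_uniq !fset_uniq andbT/= -all_predC; apply/allP => i iB.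
    by apply/negP => iX; move/fdisjointP : XB => /(_ _ iX); rewrite iB.
  by move=> i; rewrite mem_cat inE.
move: ltX; rewrite fsbig_finite//= sumEFin -(fineK s_fin) -EFinB lte_fin lee_fin.
by move=> h1 h2; lra.
Qed.

(** Meaningful for [b] dominated by a summable family, as in [usum_unif]. *)
Definition usum b : R := lim (partial_sum b @ totally).

(** The finite set [A0] depends on the dominating family only: this is what makes
    a series of functions with a common summable bound converge uniformly. *)
Lemma usum_unif a : (forall i, 0 <= a i) ->
  (\esum_(i in [set: I]) (a i)%:E < +oo)%E ->
  forall e, 0 < e -> exists A0, forall b, (forall i, `|b i| <= a i) ->
    forall A, A0 `<=` A -> `|usum b - \sum_(i <- A) b i| <= e.
Proof.
move=> a0 sa.
have key e : 0 < e -> exists A0, forall b, (forall i, `|b i| <= a i) ->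
    forall A, A0 `<=` A -> `|\sum_(i <- A0) b i - \sum_(i <- A) b i| < e.
  move=> e0; have [A0 tA0] := esum_tail a0 sa e0; exists A0 => b ba A A0A.
  have -> : \sum_(i <- A) b i = (\sum_(i <- A0) b i + \sum_(i <- A `\` A0) b i)%R.
    rewrite -big_cat; apply: perm_big; apply: uniq_perm; first exact: fset_uniq.
      rewrite cat_uniq !fset_uniq andbT/= -all_predC; apply/allP => i.
      by rewrite !inE => /andP[].
    move=> i; rewrite mem_cat !inE; case: (boolP (i \in A0)) => //= iA0.
    exact: (fsubsetP A0A).
  rewrite opprD addNKr normrN; apply: (@le_lt_trans _ _ (\sum_(i <- A `\` A0) a i)).
    by apply: (le_trans (ler_norm_sum _ _ _)); apply: ler_sum.
  by apply: tA0; apply/fdisjointP => i iA0; rewrite !inE iA0.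
have cv b : (forall i, `|b i| <= a i) -> cvg (partial_sum b @ totally).
  move=> ba; apply: cauchy_cvg; apply: cauchy_exP => e e0.
  have [A0 hA0] := key e e0; exists (\sum_(i <- A0) b i).
  by exists A0 => // A A0A /=; rewrite partial_sumE; exact: hA0.
move=> e e0; have [A0 hA0] := key _ (divr_gt0 e0 (ltr0n _ 2)); exists A0 => b ba A A0A.
have h : `|usum b - \sum_(i <- A0) b i| <= e / 2.
  apply/ler_addgt0Pl => d d0.
  have : \forall B \near totally, ball (usum b) d (partial_sum b B).
    exact: (cvg_ball (cv b ba)).
  move=> [B _ /(_ (B `|` A0) (fsubsetUl _ _))/=]; rewrite partial_sumE /ball/= => h1.
  rewrite -[X in _ <= X]addr0.
  have := hA0 b ba (B `|` A0) (fsubsetUr _ _).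
  move: h1 => /ltr_normlP[h1 h2] /ltr_normlP[h3 h4].
  by rewrite addr0 ler_norml; apply/andP; split; lra.
have := hA0 b ba A A0A; move: h.
by move=> /ler_normlP[h1 h2] /ltr_normlP[h3 h4]; rewrite ler_norml; apply/andP; split; lra.
Qed.

End unordered_sums.

Section dominated_usum.
Context {R : realType} {I : choiceType}.
Variable a : I -> R.
Hypotheses (a0 : forall i, 0 <= a i)
  (sa : (\esum_(i in [set: I]) (a i)%:E < +oo)%E).
Implicit Types (b : I -> R) (A : {fset I}).
Local Open Scope fset_scope.

Lemma usum_unique b r : (forall i, `|b i| <= a i) ->
  (forall e, 0 < e -> exists A0, forall A, A0 `<=` A ->
     `|r - \sum_(i <- A) b i| <= e) ->
  usum b = r.
Proof.
move=> ba h; apply/eqP; rewrite -subr_eq0 -normr_eq0 eq_le normr_ge0 andbT.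
apply/ler_addgt0Pl => e e0; have e2 : 0 < e / 2 by rewrite divr_gt0.
have [A0 hA0] := usum_unif a0 sa e2; have [A1 hA1] := h _ e2.
have := hA0 b ba _ (fsubsetUl A0 A1); have := hA1 _ (fsubsetUr A0 A1).
move=> /ler_normlP[h1 h2] /ler_normlP[h3 h4].
by rewrite addr0 ler_norml; apply/andP; split; lra.
Qed.

Lemma usum_bounded : exists M, forall b, (forall i, `|b i| <= a i) ->
  `|usum b| <= M.
Proof.
have [A0 hA0] := usum_unif a0 sa (@ltr01 R).
exists (1 + \sum_(i <- A0) a i)%R => b ba.
have h1 := hA0 b ba A0 (fsubset_refl _).
have h2 : `|\sum_(i <- A0) b i| <= \sum_(i <- A0) a i.
  by apply: (le_trans (ler_norm_sum _ _ _)); apply: ler_sum.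
rewrite -[usum b](subrK (\sum_(i <- A0) b i)%R).
by apply: (le_trans (ler_normD _ _)); exact: lerD.
Qed.

(** Stated for [r] and [r'] bounded by 1, like the values of cosine and sine for
    which it is needed, so that the two errors add up without rescaling. *)
Lemma usum_lin b b' (r r' : R) b2 : (forall i, `|b i| <= a i) ->
  (forall i, `|b' i| <= a i) -> (forall i, `|b2 i| <= a i) -> `|r| <= 1 -> `|r'| <= 1 ->
  (forall i, b2 i = (b i * r + b' i * r')%R) ->
  usum b2 = (usum b * r + usum b' * r')%R.
Proof.
move=> ba ba' b2a r1 r1' b2E; apply: usum_unique => // e e0.
have e2 : 0 < e / 2 by rewrite divr_gt0.
have [A0 hA0] := usum_unif a0 sa e2; exists A0 => A A0A.
rewrite (eq_bigr _ (fun i _ => b2E i)) big_split/= -!mulr_suml.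
rewrite (_ : _ - _ = (usum b - \sum_(i <- A) b i) * r +
  (usum b' - \sum_(i <- A) b' i) * r')%R; last ring.
apply: (le_trans (ler_normD _ _)); rewrite !normrM.
rewrite [leRHS](splitr e); apply: lerD.
  by rewrite -[leRHS]mulr1; apply: ler_pM => //; exact: hA0.
by rewrite -[leRHS]mulr1; apply: ler_pM => //; exact: hA0.
Qed.

Lemma measurable_usum d (T : measurableType d) (D : set T) (b : I -> T -> R) :
  (forall i x, `|b i x| <= a i) -> (forall i, measurable_fun D (b i)) ->
  measurable_fun D (fun x => usum (b ^~ x)).
Proof.
move=> ba mb.
have /choice[A hA] : forall k : nat, exists A : {fset I}, forall x,
    `|usum (b ^~ x) - \sum_(i <- A) b i x| <= k.+1%:R^-1.
  move=> k; have [A0 hA0] := usum_unif a0 sa (e := k.+1%:R^-1) ltac:(by rewrite invr_gt0).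
  by exists A0 => x; apply: hA0 => // i; exact: ba.
apply: (@measurable_fun_cvg _ _ _ D (fun k x => \sum_(i <- A k) b i x)).
  by move=> k; exact: measurable_sum.
move=> x _; apply/cvgrPdist_le => e e0.
near=> k; apply: le_trans (hA k x) _; apply: ltW; near: k.
exact: (near_infty_natSinv_lt (PosNum e0)).
Unshelve. all: by end_near. Qed.

End dominated_usum.

Lemma usum_cvg (R : realType) (I : choiceType) (a b : I -> R) : (forall i, 0 <= a i) ->
  (\esum_(i in [set: I]) (a i)%:E < +oo)%E -> (forall i, `|b i| <= a i) ->
  (fun A : {fset I} => \sum_(i <- A) b i) @ totally --> usum b.
Proof.
move=> a0 sa ba; apply/cvgrPdist_le => e e0.
have [A0 hA0] := usum_unif a0 sa e0; exists A0 => // A A0A /=.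
exact: hA0.
Qed.

Lemma esum_scale_lty (R : realType) (I : choiceType) (b : I -> R) (c : R) :
  (forall i, 0 <= b i) -> 0 <= c ->
  (\esum_(i in [set: I]) (b i)%:E < +oo)%E ->
  (\esum_(i in [set: I]) (c * b i)%:E < +oo)%E.
Proof.
move=> b0 c0 sb.
have s_fin : (\esum_(i in [set: I]) (b i)%:E)%E \is a fin_num.
  by rewrite ge0_fin_numE//; apply: esum_ge0 => i _; rewrite lee_fin.
apply: (@le_lt_trans _ _ (c%:E * \esum_(i in [set: I]) (b i)%:E)%E); last first.
  by rewrite -(fineK s_fin) -EFinM ltry.
apply: ge_ereal_sup => _ [X [finX _] <-].
rewrite fsbig_finite//= sumEFin -mulr_sumr EFinM; apply: lee_wpmul2l; first by rewrite lee_fin.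
rewrite -sumEFin -fsbig_finite//; apply: esum_ge; exists X => //.
Qed.

(** * Integrals over a cube *)

Section cube.
Context {R : realType}.
Implicit Types (n : nat) (s t th : R).

Local Notation mu := (@lebesgue_rV R).

Definition cube n s : set 'rV[R]_n :=
  [set x | forall i, - (s / 2) <= x ord0 i <= s / 2].

Lemma measurable_coord n (i : 'I_n) :
  measurable_fun setT (fun x : 'rV[R]_n => x ord0 i).
Proof. exact: (@measurable_rV_coord R n i). Qed.

Lemma measurable_dotp n (k : 'rV[R]_n) : measurable_fun setT (dotp k).
Proof.
apply: measurable_sum => i; apply: measurable_funM => //.
exact: measurable_coord.
Qed.

Lemma measurable_comp_dotp n (f : R -> R) (k : 'rV[R]_n) th : continuous f ->
  measurable_fun setT (fun x => f (dotp k x + th)).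
Proof.
move=> cf; apply: (measurableT_comp (continuous_measurable_fun cf)).
by apply: measurable_funD => //; exact: measurable_dotp.
Qed.

Lemma measurable_cube n s : measurable (@cube n s).
Proof.
rewrite (_ : cube _ = \bigcap_(i in [set: 'I_n])
    (@rV_coord R n i @^-1` `[- (s / 2), s / 2]%classic)).
  apply: fin_bigcap_measurable => // i _.
  rewrite -[X in measurable X]setTI; exact: measurable_rV_coord.
apply/seteqP; split => x /= H i; first by move=> _; rewrite /= in_itv /=; exact: H.
by have := H i I; rewrite /= in_itv.
Qed.

Lemma cubeE n s : @cube n s = [set x | forall i,
   (const_mx (- (s / 2)) : 'rV[R]_n) ord0 i <= x ord0 i <=
   (const_mx (s / 2) : 'rV[R]_n) ord0 i].
Proof. by apply/seteqP; split => x /= H i; have := H i; rewrite !mxE. Qed.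

Lemma mu_cube n s : 0 <= s -> mu n (cube s) = (s ^+ n)%:E.
Proof.
move=> s0; rewrite cubeE lebesgue_rV_box; last first.
  by move=> i; rewrite !mxE; lra.
congr EFin; rewrite (eq_bigr (fun=> s)) ?big_const_ord ?iter_mulr_1//.
by move=> i _; rewrite !mxE; lra.
Qed.

Lemma mu_cube_fin n s : 0 <= s -> (mu n (cube s) < +oo)%E.
Proof. by move=> s0; rewrite mu_cube// ltry. Qed.

(** A slice of the cube is itself a box, with one side of length zero. *)
Lemma null_cube_slice n s (i : 'I_n) c : 0 <= s ->
  mu n (cube s `&` [set x | x ord0 i = c]) = 0%E.
Proof.
move=> s0; have [cs|cs] := boolP (- (s / 2) <= c <= s / 2); last first.
  rewrite [X in mu n X](_ : _ = set0) ?measure0// -subset0 => x [/(_ i)/= + xc].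
  by rewrite xc (negbTE cs).
pose a : 'rV[R]_n := \row_j (if j == i then c else - (s / 2)).
pose b : 'rV[R]_n := \row_j (if j == i then c else s / 2).
rewrite (_ : cube s `&` _ =
    [set x | forall j, a ord0 j <= x ord0 j <= b ord0 j]); last first.
  apply/seteqP; split => x /=.
    by move=> [Dx xc] j; rewrite !mxE; case: eqP => // ->; rewrite xc lexx.
  move=> H; split=> [j|].
    have := H j; rewrite !mxE; case: eqP => // _ /andP[h1 h2].
    by apply/andP; move: cs => /andP[]; split; lra.
  have := H i; rewrite !mxE eqxx => h.
  by apply/eqP; rewrite eq_le andbC.
rewrite lebesgue_rV_box; last first.
  by move=> j; rewrite !mxE; case: ifP => _ //; lra.
by rewrite (bigD1 i)//= !mxE eqxx subrr mul0r.
Qed.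

Lemma bounded_integrable n s (f : 'rV[R]_n -> R) M : 0 <= s ->
  measurable_fun (cube s) f -> (forall x, cube s x -> `|f x| <= M) ->
  (mu n).-integrable (cube s) (EFin \o f).
Proof.
move=> s0 mf fM; apply: measurable_bounded_integrable => //.
- exact: measurable_cube.
- exact: mu_cube_fin.
- exists M; split; rewrite ?num_real // => x Mx y yD.
  exact: (le_trans (fM _ yD) (ltW Mx)).
Qed.

Lemma dotp_cons n (k : 'rV[R]_n.+1) (p : measurableTypeR R * 'rV[R]_n) :
  dotp k (rV_cons p) = k ord0 ord0 * p.1 + dotp (rV_uncons k).2 p.2.
Proof.
rewrite /dotp big_ord_recl rV_cons0; congr (_ + _).
by apply: eq_bigr => i _; rewrite rV_consS mxE.
Qed.

Lemma preimage_cube n s : @rV_cons R n @^-1` (cube s) =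
  `[- (s / 2), s / 2]%classic `*` cube s.
Proof.
apply/seteqP; split => [[u x]/= H|[u x]/= [H1 H2] i].
  split; first by rewrite in_itv/=; have := H ord0; rewrite rV_cons0.
  by move=> i; have := H (lift ord0 i); rewrite rV_consS /=.
have [j ->|->] := unliftP ord0 i; last by move: H1; rewrite rV_cons0 in_itv.
by have := H2 j; rewrite rV_consS.
Qed.

Lemma Rintegral_cubeS n s (f : 'rV[R]_n.+1 -> R) M : 0 <= s ->
  measurable_fun setT f -> (forall x, `|f x| <= M) ->
  \int[mu n.+1]_(x in cube s) f x =
  \int[@lebesgue_measure R]_(t in `[- (s / 2), s / 2])
    \int[mu n]_(y in cube s) f (rV_cons (t, y)).
Proof.
move=> s0 mf fM.
pose I : set (measurableTypeR R) := `[- (s / 2), s / 2]%classic.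
have mI : measurable I by exact: measurable_itv.
have mfc : measurable_fun setT (f \o @rV_cons R n).
  by apply: measurableT_comp => //; exact: measurable_rV_cons.
have mIC : measurable (I `*` @cube n s).
  by apply: measurableX => //; exact: measurable_cube.
have II : (@lebesgue_measure R \x mu n)%E.-integrable (I `*` @cube n s)
     (EFin \o (f \o @rV_cons R n)).
  apply: measurable_bounded_integrable => //.
  - rewrite [X in (X < _)%E](product_measure1E _ _ mI (@measurable_cube n s)).
    rewrite [X in (X * _)%E](lebesgue_measure_itv `[- (s / 2), s / 2])/=.
    rewrite mu_cube// -EFinB; case: ifP => _; last by rewrite mul0e ltry.
    by rewrite -EFinM ltry.
  - exact: measurable_funTS.
  - exists M; split; rewrite ?num_real // => x Mx y yD.
    exact: (le_trans (fM _) (ltW Mx)).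
rewrite /Rintegral; congr fine.
transitivity (\int[(@lebesgue_measure R \x mu n)%E]_(z in I `*` @cube n s) (f (rV_cons z))%:E)%E.
  rewrite -preimage_cube.
  apply: (@integral_pushforward _ _ _ _ _ _ (@measurable_rV_cons R n) _ _ (EFin \o f)).
  - exact/measurable_EFinP.
  - by rewrite preimage_cube.
  - exact: measurable_cube.
have IT := (integrable_mkcond (EFin \o (f \o @rV_cons R n)) mIC).1 II.
rewrite [LHS]integral_mkcond -[LHS](integral12_prod_meas1 IT).
rewrite [RHS]integral_mkcond; apply: eq_integral => t _; rewrite /fubini_F patchE.
case: ifPn => tI.
  rewrite fineK.
    rewrite [RHS]integral_mkcond; apply: eq_integral => y _; rewrite !patchE.
    by rewrite in_setX tI.
  apply: integrable_fin_num; first exact: measurable_cube.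
  apply: (bounded_integrable (M := M)) => //.
  apply: measurable_funTS.
  apply: (measurableT_comp mfc); exact: measurable_pair1.
apply: integral0_eq => y _; rewrite patchE in_setX (negbTE tI)//.
Qed.

Lemma Rintegral_cos_itv (k th r : R) : 0 < r ->
  \int[@lebesgue_measure R]_(t in `[- r, r]) cos (k * t + th) =
  cos th * (if k == 0 then 2 * r else 2 * sin (k * r) / k).
Proof.
move=> r0; case: eqP => [->|/eqP k0].
  rewrite (@eq_Rintegral _ _ _ _ _ (fun=> cos th)); last by move=> x _; rewrite mul0r add0r.
  rewrite Rintegral_cst//= lebesgue_measure_itv/= lte_fin ifT; last lra.
  by rewrite -EFinB/=; lra.
have rr : - r < r by lra.
have der (t : R) : is_derive t 1 (fun t : R => sin (k * t + th) / k) (cos (k * t + th)).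
  apply: is_derive_eq.
  by rewrite /GRing.scale/=; field.
rewrite /Rintegral.
rewrite (@continuous_FTC2 R (fun t => cos (k * t + th)) (fun t => sin (k * t + th) / k))//.
- rewrite -EFinB/= mulrN !(sinD, cosD) sinN cosN; field.
  exact: k0.
- apply: continuous_subspaceT => t; apply: continuous_comp; last exact: continuous_cos.
  by apply: cvgD; [apply: cvgM; [exact: cvg_cst|exact: cvg_id]|exact: cvg_cst].
- have cF : continuous (fun t : R => sin (k * t + th) / k).
    by move=> t; apply: differentiable_continuous; apply/derivable1_diffP; apply: ex_derive.
  split.
  + by move=> t _; apply: ex_derive.
  + exact/cvg_at_right_filter/cF.
  + exact/cvg_at_left_filter/cF.
- by move=> t _; rewrite derive1E; apply: derive_val.
Qed.

(** The arbitrary phase [th] makes the induction on the dimension work: the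
    integral over the remaining coordinates sees [th] shifted by the first one,
    and contributes a factor independent of it because sine is odd. *)
Lemma Rintegral_cos_cube n s (k : 'rV[R]_n) th : 0 < s ->
  \int[mu n]_(x in cube s) cos (dotp k x + th) =
  cos th * \prod_i (if k ord0 i == 0 then 2 * (s / 2)
                    else 2 * sin (k ord0 i * (s / 2)) / k ord0 i).
Proof.
move=> s0; have s0' := ltW s0; elim: n k th => [|n IHn] k th.
  rewrite big_ord0 mulr1 (@eq_Rintegral _ _ _ _ _ (fun=> cos th)); last first.
    by move=> x _; rewrite /dotp big_ord0 add0r.
  rewrite Rintegral_cst; last exact: measurable_cube.
  by rewrite [X in fine X](mu_cube 0 s0') expr0 mulr1.
rewrite (@Rintegral_cubeS _ _ _ 1)//; last 2 first.
- exact: (measurable_comp_dotp _ _ (@continuous_cos R)).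
- by move=> x; exact: cos_max.
under eq_Rintegral do [under eq_Rintegral do
  (rewrite dotp_cons addrAC addrC /=; over); rewrite IHn].
rewrite big_ord_recl /=.
set P := \prod_(i < n) _.
have -> : P = \prod_(i < n) (if k ord0 (lift ord0 i) == 0 then 2 * (s / 2)
                    else 2 * sin (k ord0 (lift ord0 i) * (s / 2)) / k ord0 (lift ord0 i)).
  by apply: eq_bigr => i _; rewrite !mxE.
rewrite RintegralZr//=; last first.
  apply: continuous_compact_integrable; first exact: segment_compact.
  apply: continuous_subspaceT => t; apply: continuous_comp; last exact: continuous_cos.
  by apply: cvgD; [apply: cvgM; [exact: cvg_cst|exact: cvg_id]|exact: cvg_cst].
by rewrite Rintegral_cos_itv ?divr_gt0// [RHS]mulrA.
Qed.

End cube.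

(** * Uniqueness of Fourier coefficients *)

Section threshold.
Context {R : realType}.
Implicit Types (y : R) (k : nat).

Lemma bernoulli_ineq y k : -1 <= y -> 1 + k%:R * y <= (1 + y) ^+ k.
Proof.
move=> y1; elim: k => [|k IH]; first by rewrite mul0r addr0 expr0.
rewrite exprS -natr1; apply: (@le_trans _ _ ((1 + y) * (1 + k%:R * y))).
  have : 0 <= k%:R * y ^+ 2 by rewrite mulr_ge0// sqr_ge0.
  by rewrite expr2; lra.
by apply: ler_wpM2l => //; lra.
Qed.

(** Converges to the indicator of [y < 1/2] on [0, 1] minus the point 1/2: the
    exponent [2^k] compares [y^k] with [2^-k], by Bernoulli's inequality. *)
Definition threshold k y : R := (1 - y ^+ k) ^+ (2 ^ k).

Lemma threshold01 k y : 0 <= y <= 1 -> 0 <= threshold k y <= 1.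
Proof.
move=> /andP[y0 y1]; rewrite /threshold.
have h0 : 0 <= y ^+ k by exact: exprn_ge0.
have h1 : y ^+ k <= 1 by exact: exprn_ile1.
by rewrite exprn_ge0 ?exprn_ile1//; lra.
Qed.

Lemma threshold_cvg1 y : 0 <= y -> y < 2^-1 -> threshold ^~ y @ \oo --> (1 : R).
Proof.
move=> y0 y2; have y01 : 0 <= y <= 1 by apply/andP; split; lra.
have h k : 1 - (2 * y) ^+ k <= threshold k y.
  have := @bernoulli_ineq (- y ^+ k) (2 ^ k) _.
  rewrite mulrN natrX -exprMn_comm; last exact: mulrC.
  by apply; rewrite lerN2; apply: exprn_ile1 => //; lra.
apply: (@squeeze_cvgr _ _ _ _ (fun k => 1 - (2 * y) ^+ k) (fun=> 1)).
- by apply: nearW => k; rewrite h/=; have /andP[] := threshold01 k y01.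
- rewrite -[X in _ --> X]subr0; apply: cvgB; first exact: cvg_cst.
  by apply: cvg_expr; rewrite ger0_norm; lra.
- exact: cvg_cst.
Qed.

Lemma threshold_cvg0 y : 2^-1 < y -> y <= 1 -> threshold ^~ y @ \oo --> (0 : R).
Proof.
move=> y2 y1; have y01 : 0 <= y <= 1 by apply/andP; split; lra.
have h k : threshold k y <= ((2 * y)^-1) ^+ k.
  have y0 : 0 <= y ^+ k by apply: exprn_ge0; lra.
  have y1' : y ^+ k <= 1 by apply: exprn_ile1 => //; lra.
  have := @bernoulli_ineq (y ^+ k) (2 ^ k) _.
  rewrite natrX -exprMn_comm; last exact: mulrC.
  move=> /(_ ltac:(lra)) b1.
  rewrite exprVn -[leRHS]mul1r ler_pdivlMr; last by apply: exprn_gt0; lra.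
  (* (1 - t)^N = (1 - t^2)^N / (1 + t)^N <= 1 / (1 + N t), with t = y^k *)
  apply: (@le_trans _ _ (threshold k y * (1 + y ^+ k) ^+ (2 ^ k))).
    apply: ler_wpM2l; last lra.
    by have /andP[] := threshold01 k y01.
  rewrite /threshold -exprMn_comm; last exact: mulrC.
  by apply: exprn_ile1; nra.
apply: (@squeeze_cvgr _ _ _ _ (fun=> 0) (fun k => ((2 * y)^-1) ^+ k)).
- apply: nearW => k; rewrite h andbT.
  by have /andP[] := threshold01 k y01.
- exact: cvg_cst.
- apply: cvg_expr; rewrite ger0_norm; last by rewrite invr_ge0; lra.
  by rewrite invf_lt1; lra.
Qed.

End threshold.

Section multipliers.
Context {R : realType} (n : nat).
Variables (s w : R) (u : 'rV[R]_n -> R).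
Local Notation mu := (@lebesgue_rV R n).
Local Notation D := (@cube R n s).
Hypothesis iu : mu.-integrable D (EFin \o u).
Implicit Types (f g : 'rV[R]_n -> R) (m : 'rV[int]_n).

Definition phase m (x : 'rV[R]_n) : R := 2 * pi * dotp (int_rV m) x * w.

Definition bdd_meas f : Prop :=
  measurable_fun D f /\ exists M, forall x, D x -> `|f x| <= M.

(** With all phases [th] this is orthogonality of [u * f] to both the cosine and
    the sine of each frequency, and the product formula for cosines stays within
    the family. *)
Definition trig_orth f : Prop := bdd_meas f /\
  forall m th, \int[mu]_(x in D) (u x * f x * cos (phase m x + th)) = 0.

Definition multiplier f : Prop := bdd_meas f /\
  forall g, trig_orth g -> trig_orth (fun x => g x * f x).

Lemma measurable_cos_phase m th :
  measurable_fun setT (fun x => cos (phase m x + th)).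
Proof.
apply: (measurableT_comp (continuous_measurable_fun (@continuous_cos R))).
apply: measurable_funD => //; apply: measurable_funM => //.
by apply: measurable_funM => //; exact: measurable_dotp.
Qed.

Lemma bdd_meas_cos m th : bdd_meas (fun x => cos (phase m x + th)).
Proof.
split; first by apply: measurable_funTS; exact: measurable_cos_phase.
by exists 1 => x _; exact: cos_max.
Qed.

Lemma bdd_meas_cst c : bdd_meas (fun=> c).
Proof. by split => //; exists `|c|. Qed.

Lemma bdd_measD f g : bdd_meas f -> bdd_meas g -> bdd_meas (fun x => f x + g x).
Proof.
move=> [mf [M fM]] [mg [N gN]]; split; first exact: measurable_funD.
exists (M + N) => x Dx; apply: (le_trans (ler_normD _ _)).
by apply: lerD; [exact: fM|exact: gN].
Qed.

Lemma bdd_measM f g : bdd_meas f -> bdd_meas g -> bdd_meas (fun x => f x * g x).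
Proof.
move=> [mf [M fM]] [mg [N gN]]; split; first exact: measurable_funM.
exists (M * N) => x Dx; rewrite normrM.
by apply: ler_pM => //; [exact: fM|exact: gN].
Qed.

Lemma integrable_bdd f : bdd_meas f ->
  mu.-integrable D (EFin \o (fun x => u x * f x)).
Proof.
move=> [mf [M fM]].
have := @integrableMl _ _ _ mu _ (@measurable_cube R n s) (EFin \o u) f iu mf.
apply; exists M; split; rewrite ?num_real // => y My x xD.
exact: (le_trans (fM _ xD) (ltW My)).
Qed.

Lemma integrable_bddM f g : bdd_meas f -> bdd_meas g ->
  mu.-integrable D (EFin \o (fun x => u x * f x * g x)).
Proof.
move=> bf bg; have := integrable_bdd (bdd_measM bf bg).
by congr (is_true (_.-integrable _ _)); apply/funext => x /=; rewrite mulrA.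
Qed.

Lemma trig_orthD f g : trig_orth f -> trig_orth g ->
  trig_orth (fun x => f x + g x).
Proof.
move=> [bf of_] [bg og]; split; first exact: bdd_measD.
move=> m th; under eq_Rintegral do rewrite mulrDr mulrDl.
rewrite RintegralD ?of_ ?og ?addr0//.
- exact: measurable_cube.
- exact: integrable_bddM (bdd_meas_cos _ _).
- exact: integrable_bddM (bdd_meas_cos _ _).
Qed.

Lemma trig_orthZ c f : trig_orth f -> trig_orth (fun x => f x * c).
Proof.
move=> [bf of_]; split; first exact: bdd_measM (bdd_meas_cst c).
move=> m th; under eq_Rintegral do rewrite mulrA mulrAC.
rewrite RintegralZr ?of_ ?mul0r//.
- exact: measurable_cube.
- exact: integrable_bddM (bdd_meas_cos _ _).
Qed.

Lemma trig_orth_lim (F : nat -> 'rV[R]_n -> R) f M :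
  (forall k, trig_orth (F k)) -> (forall k x, D x -> `|F k x| <= M) ->
  bdd_meas f -> {ae mu, forall x, D x -> F ^~ x @ \oo --> f x} ->
  trig_orth f.
Proof.
move=> oF FM bf cF; split => // m th.
pose G k x := u x * F k x * cos (phase m x + th).
have mD := @measurable_cube R n s.
have mu_u : measurable_fun D u by case/integrableP : iu => /measurable_EFinP.
have GE k : (\int[mu]_(x in D) (EFin \o G k) x = 0)%E.
  have [_ /(_ m th)] := oF k; rewrite /Rintegral /G /= => h.
  rewrite -[LHS]fineK ?h//.
  apply: integrable_fin_num => //.
  by apply: integrable_bddM (bdd_meas_cos _ _); have [] := oF k.
have mG k : measurable_fun D (EFin \o G k).
  apply/measurable_EFinP; apply: measurable_funM; last exact: (bdd_meas_cos _ _).1.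
  by apply: measurable_funM => //; case: (oF k) => -[].
pose g x := u x * f x * cos (phase m x + th).
have mg : measurable_fun D (EFin \o g).
  apply/measurable_EFinP; apply: measurable_funM; last exact: (bdd_meas_cos _ _).1.
  by apply: measurable_funM => //; case: bf.
have cG : {ae mu, forall x, D x -> (EFin \o G k) x @[k --> \oo] --> (EFin \o g) x}.
  apply: filterS cF => x h Dx; apply: cvg_EFin; first exact: nearW.
  apply: cvgM; last exact: cvg_cst.
  by apply: cvgM; [exact: cvg_cst|exact: h].
have iM : mu.-integrable D (EFin \o (fun x => `|u x| * `|M|)).
  apply: (@integrableMl _ _ _ mu _ mD (EFin \o (fun x => `|u x|)) (cst `|M|)) => //.
    by have := integrable_abse iu.
  by exists `|M|; split; rewrite ?num_real // => y My x xD /=; rewrite normr_id ltW.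
have GM : {ae mu, forall x k, D x ->
    (`|(EFin \o G k) x| <= (EFin \o (fun x => `|u x| * `|M|)%R) x)%E}.
  apply: nearW => x k Dx; rewrite lee_fin /G !normrM -mulrA.
  apply: ler_wpM2l => //; rewrite -[leRHS]mulr1.
  apply: ler_pM => //; last exact: cos_max.
  by apply: (le_trans (FM _ _ Dx)); exact: ler_norm.
have [_ _] := dominated_convergence mD mG mg cG iM GM.
have cvg0 : [sequence (\int[mu]_(x in D) (EFin \o G k) x)%E]_k @ \oo --> 0%E.
  rewrite (_ : [sequence _]_k = cst 0%E); first exact: cvg_cst.
  by apply/funext => k /=; rewrite -[RHS](GE k).
by rewrite /Rintegral => /(cvg_unique _ cvg0) <-.
Qed.

Lemma multiplier_cst c : multiplier (fun=> c).
Proof. by split; [exact: bdd_meas_cst|move=> g; exact: trig_orthZ]. Qed.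

Lemma multiplierD f g : multiplier f -> multiplier g ->
  multiplier (fun x => f x + g x).
Proof.
move=> [bf mf] [bg mg]; split; first exact: bdd_measD.
move=> h oh; under eq_fun do rewrite mulrDr.
by apply: trig_orthD; [exact: mf|exact: mg].
Qed.

Lemma multiplierM f g : multiplier f -> multiplier g ->
  multiplier (fun x => f x * g x).
Proof.
move=> [bf mf] [bg mg]; split; first exact: bdd_measM.
by move=> h oh; under eq_fun do rewrite mulrA; exact/mg/mf.
Qed.

Lemma multiplierB f g : multiplier f -> multiplier g ->
  multiplier (fun x => f x - g x).
Proof.
move=> mf mg; under eq_fun do rewrite -mulN1r.
by apply: multiplierD => //; apply: multiplierM => //; exact: multiplier_cst.
Qed.

Lemma multiplierX f k : multiplier f -> multiplier (fun x => f x ^+ k).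
Proof.
move=> mf; elim: k => [|k IH]; first exact: multiplier_cst.
by under eq_fun do rewrite exprS; exact: multiplierM.
Qed.

Lemma phaseD m k x : phase (m + k) x = phase m x + phase k x.
Proof.
rewrite /phase (_ : dotp _ _ = dotp (int_rV m) x + dotp (int_rV k) x); first ring.
by rewrite /dotp -big_split; apply: eq_bigr => i _ /=; rewrite !mxE intrD mulrDl.
Qed.

Lemma phaseN m x : phase (- m) x = - phase m x.
Proof.
rewrite /phase (_ : dotp _ _ = - dotp (int_rV m) x); first ring.
by rewrite /dotp -sumrN; apply: eq_bigr => i _ /=; rewrite !mxE intrN mulNr.
Qed.

(** The product of two characters is the mean of the characters at the sum and
    the difference of the frequencies. *)
Lemma multiplier_cos k th : multiplier (fun x => cos (phase k x + th)).
Proof.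
split=> [|g [bg og]]; first exact: bdd_meas_cos.
split=> [|m th']; first exact: bdd_measM (bdd_meas_cos _ _).
rewrite (@eq_Rintegral _ _ _ _ _ (fun x =>
  u x * g x * cos (phase (m + k) x + (th' + th)) * 2^-1 +
  u x * g x * cos (phase (m - k) x + (th' - th)) * 2^-1)); last first.
  move=> x _; rewrite !phaseD phaseN.
  rewrite (_ : phase m x + phase k x + (th' + th) =
    (phase m x + th') + (phase k x + th)); last ring.
  rewrite (_ : phase m x - phase k x + (th' - th) =
    (phase m x + th') - (phase k x + th)); last ring.
  by rewrite [cos (_ - _)]cosD [cos (phase m x + th' + _)]cosD cosN sinN; field.
have bc m' t := integrable_bddM bg (bdd_meas_cos m' t).
have bc2 m' t : mu.-integrable D
    (EFin \o (fun x => u x * g x * cos (phase m' x + t) * 2^-1)).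
  have := integrable_bddM (bdd_measM bg (bdd_meas_cos m' t)) (bdd_meas_cst 2^-1).
  by congr (is_true (_.-integrable _ _)); apply/funext => x /=; rewrite !mulrA.
rewrite RintegralD ?RintegralZr ?og ?mul0r ?addr0//; exact: measurable_cube.
Qed.

Lemma multiplier_lim (F : nat -> 'rV[R]_n -> R) f M :
  (forall k, multiplier (F k)) -> (forall k x, D x -> `|F k x| <= M) ->
  measurable_fun D f -> (forall x, D x -> `|f x| <= M) ->
  {ae mu, forall x, D x -> F ^~ x @ \oo --> f x} ->
  multiplier f.
Proof.
move=> mF FM mf fM cF; have bf : bdd_meas f by split => //; exists M.
split=> // g og; have [[_ [N gN]] _] := og.
apply: (@trig_orth_lim (fun k x => g x * F k x) _ (N * M)).
- by move=> k; case: (mF k) => _; exact.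
- by move=> k x Dx; rewrite normrM; apply: ler_pM => //; [exact: gN|exact: FM].
- by apply: bdd_measM bf; case: og.
- apply: filterS cF => x h Dx; apply: cvgM; [exact: cvg_cst|exact: h].
Qed.

End multipliers.

Section uniqueness.
Context {R : realType} (n : nat).
Variables (s w : R) (u : 'rV[R]_n -> R).
Hypotheses (s0 : 0 < s) (ws : `|w| * s = 1).
Local Notation mu := (@lebesgue_rV R n).
Local Notation D := (@cube R n s).
Hypothesis iu : mu.-integrable D (EFin \o u).
Local Notation multiplier := (multiplier s w u).

(** For [x_i] in the open cube the second sine is positive, and the first has the
    sign of [x_i - b]; the product of the two sines is a constant plus a multiple
    of a cosine of the basic frequency, because the sum of their arguments does
    not depend on [x]. *)
Definition half_space_fun (i : 'I_n) (b : R) (x : 'rV[R]_n) : R :=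
  2^-1 + sin (pi * (x ord0 i - b) / s) * sin (pi * (s / 2 - x ord0 i) / s) / 2.

(** With [A] and [B] the arguments of the two sines, this is
    [sin A sin B = (cos (A - B) - cos (A + B)) / 2]. *)
Lemma multiplier_half_space_fun i b : multiplier (half_space_fun i b).
Proof.
pose c := - (pi * (b + s / 2) / s); pose d := pi * (s / 2 - b) / s.
have [th hth] : exists th, forall x : 'rV[R]_n,
    cos (2 * pi * x ord0 i / s + c) = cos (phase w (delta_mx ord0 i) x + th).
  have ph x : phase w (delta_mx ord0 i) x = 2 * pi * x ord0 i * w.
    rewrite /phase /dotp (bigD1 i)//= big1 ?addr0; last first.
      by move=> j ji; rewrite !mxE eqxx (negbTE ji) mul0r.
    by rewrite !mxE !eqxx mul1r.
  (* 1 / s is w or - w, and cosine is even *)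
  have [w0|w0] := leP 0 w.
    have ws' : s^-1 = w.
      by move: ws; rewrite ger0_norm// => h; rewrite -[LHS]mul1r -h mulfK// gt_eqF.
    by exists c => x; rewrite ph ws'.
  exists (- c) => x; rewrite ph -cosN; congr cos.
  have ws' : s^-1 = - w.
    by move: ws; rewrite ltr0_norm// => h; rewrite -[LHS]mul1r -h mulfK// gt_eqF.
  by rewrite ws'; ring.
rewrite (_ : half_space_fun i b = (fun x => (2^-1 - cos d / 4) +
    cos (phase w (delta_mx ord0 i) x + th) * 4^-1)).
  apply: multiplierD => //; first exact: multiplier_cst.
  by apply: multiplierM => //; [exact: multiplier_cos|exact: multiplier_cst].
apply/funext => x; rewrite -hth /half_space_fun.
set A := pi * (x ord0 i - b) / s; set B := pi * (s / 2 - x ord0 i) / s.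
have -> : 2 * pi * x ord0 i / s + c = A - B by rewrite /A /B /c; field; rewrite gt_eqF.
have -> : d = A + B by rewrite /A /B /d; field; rewrite gt_eqF.
by rewrite cosB cosD; field.
Qed.

Lemma half_space_fun01 i b x : 0 <= half_space_fun i b x <= 1.
Proof.
rewrite /half_space_fun; set A := sin _; set B := sin _.
have A1 : `|A| <= 1 by exact: sin_max.
have B1 : `|B| <= 1 by exact: sin_max.
have : `|A * B| <= 1 by rewrite normrM; apply: mulr_ile1.
by move=> /ler_normlP[h1 h2]; apply/andP; split; lra.
Qed.

Lemma half_space_fun_sign i b (x : 'rV[R]_n) :
  - (s / 2) < b -> b <= s / 2 -> - (s / 2) < x ord0 i -> x ord0 i < s / 2 ->
  (x ord0 i < b -> half_space_fun i b x < 2^-1) /\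
  (b < x ord0 i -> 2^-1 < half_space_fun i b x).
Proof.
move=> b1 b2 x1 x2; rewrite /half_space_fun.
have pos (t : R) : 0 < t -> t < s -> 0 < sin (pi * t / s).
  move=> t0 t1; apply: sin_gt0_pi; apply/andP; split; first by rewrite divr_gt0 ?mulr_gt0 ?pi_gt0.
  by rewrite ltr_pdivrMr// ltr_pM2l ?pi_gt0.
have hB : 0 < sin (pi * (s / 2 - x ord0 i) / s) by apply: pos; lra.
split=> xb.
- have hA : 0 < sin (pi * (b - x ord0 i) / s) by apply: pos; lra.
  have -> : pi * (x ord0 i - b) / s = - (pi * (b - x ord0 i) / s).
    by field; rewrite gt_eqF.
  rewrite sinN; have := mulr_gt0 hA hB; lra.
- have hA : 0 < sin (pi * (x ord0 i - b) / s) by apply: pos; lra.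
  by have := mulr_gt0 hA hB; lra.
Qed.

Definition indic (A : set 'rV[R]_n) (x : 'rV[R]_n) : R := \1_A x.

Lemma ae_off_slice (i : 'I_n) c :
  {ae mu, forall x, D x -> x ord0 i <> c}.
Proof.
exists (D `&` [set x | x ord0 i = c]); split.
- apply: measurableI; first exact: measurable_cube.
  rewrite -[X in measurable X]setTI.
  exact: (@measurable_rV_coord R n i measurableT [set c]).
- exact: null_cube_slice (ltW s0).
- move=> x /= H; split.
    by apply: contrapT => nD; apply: H => /nD.
  by apply: contrapT => nD; apply: H.
Qed.

(** The limit of [threshold k] of the separating function is the indicator off
    the slice [x_i = b] and the two faces of the cube, which are null. *)
Lemma multiplier_half_space i b : multiplier (indic [set x | x ord0 i < b]).
Proof.
have m_half : measurable [set x : 'rV[R]_n | x ord0 i < b].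
  rewrite (_ : [set x : 'rV[R]_n | _] = setT `&` @rV_coord R n i @^-1` `]-oo, b[%classic).
    by apply: measurable_rV_coord => //; exact: measurable_itv.
  rewrite setTI.
  by apply/seteqP; split => x /=; rewrite in_itv.
have mi : measurable_fun D (indic [set x | x ord0 i < b]).
  exact: measurable_indic.
have i1 x : `|indic [set x | x ord0 i < b] x| <= 1.
  by rewrite /indic indicE; case: (_ \in _); rewrite ?normr1 ?normr0.
have ext c : (forall x, D x -> indic [set x | x ord0 i < b] x = c) ->
    multiplier (indic [set x | x ord0 i < b]).
  move=> h; apply: (@multiplier_lim _ _ s w u iu (fun _ _ => c) _ (Num.max 1 `|c|)) => //.
  - by move=> _; exact: multiplier_cst.
  - by move=> _ x _; rewrite le_max lexx orbT.
  - by move=> x _; rewrite le_max i1.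
  - by apply: nearW => x Dx; rewrite h//; exact: cvg_cst.
have [b1|b1] := leP b (- (s / 2)).
  apply: (ext 0) => x /(_ i)/andP[x1 _]; rewrite /indic indicE memNset//=.
  by apply/negP; rewrite -leNgt; exact: le_trans x1.
have [b2|b2] := ltP (s / 2) b.
  apply: (ext 1) => x /(_ i)/andP[_ x1]; rewrite /indic indicE mem_set//=.
  exact: le_lt_trans b2.
apply: (@multiplier_lim _ _ s w u iu
    (fun k x => threshold k (half_space_fun i b x)) _ 1) => //.
- move=> k; rewrite /threshold; apply: multiplierX => //.
  apply: multiplierB => //; first exact: multiplier_cst.
  by apply: multiplierX => //; exact: multiplier_half_space_fun.
- move=> k x _; have /andP[h1 h2] := threshold01 k (half_space_fun01 i b x).
  by rewrite ger0_norm.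
- have h1 := ae_off_slice i b; have h2 := ae_off_slice i (- (s / 2)).
  have h3 := ae_off_slice i (s / 2).
  apply: filterS3 h1 h2 h3 => x h1 h2 h3 Dx.
  have {}h1 := h1 Dx; have {}h2 := h2 Dx; have {}h3 := h3 Dx.
  have /andP[x1 x2] := Dx i.
  have {}x1 : - (s / 2) < x ord0 i by rewrite lt_neqAle x1 andbT; apply/eqP => /esym.
  have {}x2 : x ord0 i < s / 2 by rewrite lt_neqAle x2 andbT; exact/eqP.
  have [lo hi] := half_space_fun_sign b1 b2 x1 x2.
  have /andP[f0 f1] := half_space_fun01 i b x.
  have [xb|xb|//] := ltgtP (x ord0 i) b.
    by rewrite /indic indicE mem_set//; apply: threshold_cvg1 => //; exact: lo.
  rewrite /indic indicE memNset//=; last by apply/negP; rewrite -leNgt ltW.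
  by apply: threshold_cvg0 => //; exact: hi.
Qed.

Lemma multiplier_setC A : multiplier (indic A) -> multiplier (indic (~` A)).
Proof.
move=> mA; rewrite (_ : indic _ = fun x => 1 - indic A x).
  by apply: multiplierB => //; exact: multiplier_cst.
apply/funext => x; rewrite /indic !indicE in_setC.
by case: (x \in A); rewrite ?subrr ?subr0.
Qed.

(** The indicator of a finite union is [1 - prod (1 - indic)], and increases to
    that of the union. *)
Lemma multiplier_bigcup (F : (set 'rV[R]_n)^nat) :
  (forall k, multiplier (indic (F k))) -> multiplier (indic (\bigcup_k F k)).
Proof.
move=> mF; pose G k x : R := 1 - \prod_(j < k) (1 - indic (F j) x).
have cG x : G ^~ x @ \oo --> indic (\bigcup_k F k) x.
  have [[j _ Fjx]|nF] := pselect ((\bigcup_k F k) x).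
    apply: cvg_near_cst; exists j.+1 => //= k /= jk.
    rewrite /G (bigD1 (Ordinal jk))//= /indic !indicE mem_set// mem_set; last by exists j.
    by rewrite subrr mul0r subr0.
  rewrite (_ : G ^~ x = cst (indic (\bigcup_k F k) x)); first exact: cvg_cst.
  apply/funext => k; rewrite /G big1 ?subrr /indic ?indicE ?memNset//.
  by move=> j _; rewrite indicE memNset ?subr0// => Fj; apply: nF; exists j.
have G1 k x : `|G k x| <= 1.
  rewrite /G; have [h0 h1] : 0 <= \prod_(j < k) (1 - indic (F j) x) /\
     \prod_(j < k) (1 - indic (F j) x) <= 1.
    have h (j : 'I_k) : 0 <= 1 - indic (F j) x <= 1.
      by rewrite /indic indicE; case: (_ \in _); rewrite ?subrr ?subr0 ?lexx ?ler01.
    split; first by apply: prodr_ge0 => j _; have /andP[] := h j.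
    by apply: prodr_ile1 => j _.
  by rewrite ger0_norm; lra.
have mG k : multiplier (G k).
  apply: multiplierB => //; first exact: multiplier_cst.
  elim: k => [|k IH].
    by under eq_fun do rewrite big_ord0; exact: multiplier_cst.
  under eq_fun do rewrite big_ord_recr/=.
  apply: multiplierM => //; apply: multiplierB => //; exact: multiplier_cst.
apply: (@multiplier_lim _ _ s w u iu G _ 1) => //.
- apply: (@measurable_fun_cvg _ _ _ D G) => //.
  by move=> k; have [[]] := mG k.
- by move=> x _; rewrite /indic indicE; case: (_ \in _); rewrite ?normr1 ?normr0.
- exact: nearW.
Qed.

(** Both in the space and, for a fixed coordinate, on the line, the sets with a
    multiplier as indicator form a sigma-algebra; open half-lines generate the
    Borel sets of the line. *)
Lemma multiplier_measurable A : measurable A -> multiplier (indic A).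
Proof.
suff : @g_sigma_preimage _ _ _ n (@rV_coord R n) `<=` [set A | multiplier (indic A)].
  by move=> h mA; exact: h.
apply: smallest_sub.
  split.
  - rewrite /= (_ : indic set0 = fun=> 0); first exact: multiplier_cst.
    by apply/funext => x; rewrite /indic indicE in_set0.
  - by move=> B mB /=; rewrite setTD; exact: multiplier_setC.
  - by move=> F mF /=; exact: multiplier_bigcup.
rewrite -bigcup_seq/=; apply: bigcup_sub => i _ B [C mC <-]; rewrite setTI.
have {}mC : (@RGenInftyO.G R).-sigma.-measurable C by rewrite -RGenInftyO.measurableE.
move: C mC.
suff : (@RGenInftyO.G R).-sigma.-measurable `<=`
    [set C | multiplier (indic (@rV_coord R n i @^-1` C))] by [].
apply: smallest_sub.
  split.
  - rewrite /= preimage_set0 (_ : indic set0 = fun=> 0); first exact: multiplier_cst.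
    by apply/funext => x; rewrite /indic indicE in_set0.
  - by move=> C mC /=; rewrite setTD preimage_setC; exact: multiplier_setC.
  - by move=> F mF /=; rewrite preimage_bigcup; exact: multiplier_bigcup.
move=> _ [b ->] /=; rewrite (_ : rV_coord i @^-1` _ = [set x | x ord0 i < b]).
  exact: multiplier_half_space.
by apply/seteqP; split => x /=; rewrite in_itv.
Qed.

(** The hypothesis says that the constant 1 is orthogonal in the above sense;
    multiplying it by the indicator of [E] and testing against the frequency 0
    gives [\int_E u = 0]. *)
Theorem trig_orth_ae0 :
  (forall m th, \int[mu]_(x in D) (u x * cos (phase w m x + th)) = 0) ->
  {ae mu, forall x, D x -> u x = 0}.
Proof.
move=> h; have mD := @measurable_cube R n s.
have o1 : trig_orth s w u (fun=> 1).
  split; first exact: bdd_meas_cst.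
  by move=> m th; under eq_Rintegral do rewrite mulr1; exact: h.
have : ae_eq mu D (EFin \o u) (cst 0%E).
  apply: integral_ae_eq => // E ED mE.
  rewrite integral0.
  have [_ /(_ _ o1)[bE /(_ 0 0)]] := multiplier_measurable mE.
  have iE : mu.-integrable E (EFin \o u) by exact: integrableS iu.
  rewrite (@eq_Rintegral _ _ _ _ _ (u \_ E)); last first.
    move=> x _; rewrite /phase (_ : dotp _ _ = 0).
      rewrite mulr0 mul0r addr0 cos0 mulr1 mul1r /indic indicE patchE.
      by case: ifP; rewrite ?mulr1 ?mulr0.
    by rewrite /dotp big1// => i _; rewrite !mxE mul0r.
  rewrite -Rintegral_mkcondr (_ : D `&` E = E); last exact/setIidr.
  rewrite /Rintegral => h0; rewrite -[LHS]fineK ?h0//.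
  exact: integrable_fin_num.
by apply: filterS => x /= H Dx; have [] := H Dx.
Qed.

End uniqueness.

(** * Fourier inversion *)

Section trig_integrals.
Context {R : realType}.
Implicit Types (s w : R).
Local Notation mu := (@lebesgue_rV R).

Lemma sin_int_pi (m : int) : sin (m%:~R * pi) = 0 :> R.
Proof.
have h (k : nat) : sin (k%:R * pi) = 0 :> R.
  elim: k => [|k IH]; first by rewrite mul0r sin0.
  by rewrite -natr1 mulrDl mul1r sinDpi IH oppr0.
case: m => k; first exact: h.
by rewrite NegzE mulrNz mulNr sinN h oppr0.
Qed.

Lemma phase_dotp n w (m : 'rV[int]_n) x :
  phase w m x = dotp ((2 * pi * w) *: int_rV m) x.
Proof.
rewrite /phase /dotp mulr_sumr mulr_suml; apply: eq_bigr => i _.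
by rewrite !mxE; ring.
Qed.

(** For [m <> 0] some factor in [Rintegral_cos_cube] contains the sine of an
    integer multiple of [pi]. *)
Lemma Rintegral_cos_phase n s w (m : 'rV[int]_n) th : 0 < s -> `|w| * s = 1 ->
  \int[mu n]_(x in cube s) cos (phase w m x + th) =
  if m == 0 then cos th * s ^+ n else 0.
Proof.
move=> s0 ws; under eq_Rintegral do rewrite phase_dotp.
have w0 : w != 0 by apply: contra_eq_neq ws => ->; rewrite normr0 mul0r eq_sym oner_eq0.
rewrite Rintegral_cos_cube//; case: eqP => [->|/eqP m0].
  congr (_ * _); rewrite (eq_bigr (fun=> s)) ?big_const_ord ?iter_mulr_1//.
  by move=> i _; rewrite !mxE mulr0 eqxx; field.
have [i mi] : exists i, m ord0 i != 0.
  apply: contrapT => h; move/eqP : m0; apply; apply/rowP => i; rewrite !mxE.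
  by apply: contrapT => hi; apply: h; exists i; exact/eqP.
rewrite (bigD1 i)//= !mxE ifF; last first.
  apply/negbTE; rewrite mulf_neq0 ?intr_eq0// mulf_neq0// mulf_neq0 ?pnatr_eq0//.
  by rewrite gt_eqF ?pi_gt0.
have -> : 2 * pi * w * (m ord0 i)%:~R * (s / 2) = w * s * ((m ord0 i)%:~R * pi) by field.
suff -> : sin (w * s * ((m ord0 i)%:~R * pi)) = 0 by rewrite mulr0 !mul0r mulr0.
have [wp|wn] := leP 0 w; first by rewrite -(ger0_norm wp) ws mul1r sin_int_pi.
have -> : w * s = -1 by move: ws; rewrite ltr0_norm// mulNr => <-; rewrite opprK.
by rewrite mulN1r sinN sin_int_pi oppr0.
Qed.

Lemma integrable_cos_phase n s w (m : 'rV[int]_n) th : 0 <= s ->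
  (mu n).-integrable (cube s) (EFin \o (fun x => cos (phase w m x + th))).
Proof.
move=> s0; apply: (bounded_integrable (M := 1)) => // [|x _]; last exact: cos_max.
by apply: measurable_funTS; exact: measurable_cos_phase.
Qed.

Lemma integrableM_cos n s w (f : 'rV[R]_n -> R) (m : 'rV[int]_n) th :
  (mu n).-integrable (cube s) (EFin \o f) ->
  (mu n).-integrable (cube s) (EFin \o (fun x => f x * cos (phase w m x + th))).
Proof. by move=> if_; exact: (integrable_bdd if_ (bdd_meas_cos s w m th)). Qed.

Lemma integrableM_sin n s w (f : 'rV[R]_n -> R) (m : 'rV[int]_n) th :
  (mu n).-integrable (cube s) (EFin \o f) ->
  (mu n).-integrable (cube s) (EFin \o (fun x => f x * sin (phase w m x + th))).
Proof.
move=> if_; have := integrableM_cos w m (th - pi / 2) if_.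
congr (is_true (_.-integrable _ _)); apply/funext => x /=.
by rewrite addrA cosBpihalf.
Qed.

Lemma Rintegral_sum n s (I : eqType) (l : seq I) (b : I -> 'rV[R]_n -> R) (a : I -> R) :
  0 <= s -> (forall i x, `|b i x| <= a i) ->
  (forall i, measurable_fun setT (b i)) ->
  \int[mu n]_(x in cube s) (\sum_(i <- l) b i x) =
  \sum_(i <- l) \int[mu n]_(x in cube s) b i x.
Proof.
move=> s0 ba mb; elim: l => [|i l IH].
  rewrite big_nil; under eq_Rintegral do rewrite big_nil.
  by rewrite Rintegral_cst ?mul0r//; exact: measurable_cube.
rewrite big_cons -IH; under eq_Rintegral do rewrite big_cons.
rewrite RintegralD//; first exact: measurable_cube.
- by apply: (bounded_integrable (M := a i)) => //; exact: measurable_funTS.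
- apply: (bounded_integrable (M := \sum_(i <- l) a i)) => //.
    by apply: measurable_funTS; exact: measurable_sum.
  by move=> x _; apply: (le_trans (ler_norm_sum _ _ _)); exact: ler_sum.
Qed.

(** Uniform convergence allows integration term by term, and only the term [k]
    contributes. *)
Lemma Rintegral_usum n s (I : choiceType) (b : I -> 'rV[R]_n -> R) (a : I -> R) (k : I) :
  0 <= s -> (forall i, 0 <= a i) -> (\esum_(i in [set: I]) (a i)%:E < +oo)%E ->
  (forall i x, `|b i x| <= a i) -> (forall i, measurable_fun setT (b i)) ->
  (forall i, i != k -> \int[mu n]_(x in cube s) b i x = 0) ->
  \int[mu n]_(x in cube s) usum (b ^~ x) = \int[mu n]_(x in cube s) b k x.
Proof.
move=> s0 a0 sa ba mb b0; have mD := @measurable_cube R n s.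
have mE := measurable_usum a0 sa ba mb.
have [M hM] := usum_bounded a0 sa.
apply/eqP; rewrite -subr_eq0 -normr_eq0 eq_le normr_ge0 andbT.
have s1 : 0 < s ^+ n + 1 by rewrite ltr_wpDl// exprn_ge0.
apply/ler_addgt0Pl => e e0; rewrite addr0.
have [A0 hA0] := usum_unif a0 sa (divr_gt0 e0 s1).
pose A := (k |` A0)%fset.
have -> : \int[mu n]_(x in cube s) b k x =
    \int[mu n]_(x in cube s) \sum_(i <- A) b i x.
  rewrite (Rintegral_sum _ s0 ba mb) (bigD1_seq k)/= ?fset1U1//.
  by rewrite big1 ?addr0// => i ik; exact: b0.
have iE : (mu n).-integrable (cube s) (EFin \o (fun x => usum (b ^~ x))).
  apply: (bounded_integrable (M := M)) => //; first exact: measurable_funTS.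
  by move=> x _; apply: hM => i; exact: ba.
have iS : (mu n).-integrable (cube s) (EFin \o (fun x => \sum_(i <- A) b i x)).
  apply: (bounded_integrable (M := \sum_(i <- A) a i)) => //.
    by apply: measurable_funTS; exact: measurable_sum.
  by move=> x _; apply: (le_trans (ler_norm_sum _ _ _)); exact: ler_sum.
rewrite -RintegralB//; apply: (le_trans (le_normr_Rintegral _ _)) => //.
  by have := integrableB mD iE iS.
have ES x : `|usum (b ^~ x) - \sum_(i <- A) b i x| <= e / (s ^+ n + 1).
  by apply: hA0 => [i|]; [exact: ba|exact: fsubsetU1].
apply: (@le_trans _ _ (\int[mu n]_(x in cube s) (e / (s ^+ n + 1)))).
  apply: le_Rintegral => //.
  - apply: (bounded_integrable (M := e / (s ^+ n + 1))) => //.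
      apply: measurable_funTS; apply: measurableT_comp => //.
      by apply: measurable_funB => //; exact: measurable_sum.
    by move=> x _; rewrite normr_id.
  - apply: (bounded_integrable (M := `|e / (s ^+ n + 1)|)) => //.
rewrite Rintegral_cst// [X in fine X](mu_cube n s0)/=.
rewrite mulrAC ler_pdivrMr// ler_pM2l//; lra.
Qed.

End trig_integrals.

Section inversion.
Context {R : realType} (n : nat).
Variables (s w : R).
Hypotheses (s0 : 0 < s) (ws : `|w| * s = 1).
Local Notation mu := (@lebesgue_rV R n).
Local Notation D := (@cube R n s).
Variables (p q a : 'rV[int]_n -> R).
Hypotheses (a0 : forall m, 0 <= a m)
  (sa : (\esum_(m in [set: 'rV[int]_n]) (a m)%:E < +oo)%E)
  (pqa : forall m th, `|p m * cos th - q m * sin th| <= a m).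

(** The real and imaginary parts of [(p m + i q m) * exp (i phase m x)]. *)
Definition re_term (m : 'rV[int]_n) (x : 'rV[R]_n) : R :=
  p m * cos (phase w m x) - q m * sin (phase w m x).

Definition im_term (m : 'rV[int]_n) (x : 'rV[R]_n) : R :=
  q m * cos (phase w m x) + p m * sin (phase w m x).

Lemma re_term_le m x : `|re_term m x| <= a m. Proof. exact: pqa. Qed.

Lemma im_term_le m x : `|im_term m x| <= a m.
Proof.
have := pqa m (phase w m x - pi / 2); rewrite cosBpihalf sinBpihalf.
by rewrite /im_term mulrN opprK addrC.
Qed.

Lemma measurable_re_term m : measurable_fun setT (re_term m).
Proof.
have h th := @measurable_cos_phase R n w m th.
rewrite (_ : re_term m = fun x => p m * cos (phase w m x + 0) -
   q m * cos (phase w m x + - (pi / 2))); last first.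
  by apply/funext => x; rewrite cosBpihalf addr0.
by apply: measurable_funB; apply: measurable_funM.
Qed.

Lemma measurable_im_term m : measurable_fun setT (im_term m).
Proof.
have h th := @measurable_cos_phase R n w m th.
rewrite (_ : im_term m = fun x => q m * cos (phase w m x + 0) +
   p m * cos (phase w m x + - (pi / 2))); last first.
  by apply/funext => x; rewrite cosBpihalf addr0.
by apply: measurable_funD; apply: measurable_funM.
Qed.

Definition re_series x := usum (re_term ^~ x).
Definition im_series x := usum (im_term ^~ x).

Lemma measurable_re_series : measurable_fun setT re_series.
Proof. exact: (measurable_usum a0 sa re_term_le measurable_re_term). Qed.

Lemma measurable_im_series : measurable_fun setT im_series.
Proof. exact: (measurable_usum a0 sa im_term_le measurable_im_term). Qed.

(** The integrand is the real part of [exp (- i (phase k x + th))] times the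
    series, so its terms have the frequencies [m - k] and only [m = k] has a
    nonzero integral. *)
Lemma series_coef (k : 'rV[int]_n) (th : R) :
  \int[mu]_(x in D) (re_series x * cos (phase w k x + th) +
                     im_series x * sin (phase w k x + th)) =
  (p k * cos th + q k * sin th) * s ^+ n.
Proof.
pose b m x := p m * cos (phase w (m - k) x + - th) - q m * sin (phase w (m - k) x + - th).
have bE m x : b m x = re_term m x * cos (phase w k x + th) +
    im_term m x * sin (phase w k x + th).
  rewrite /b phaseD phaseN (_ : _ + _ + - th = phase w m x - (phase w k x + th)); last ring.
  by rewrite cosB sinB /re_term /im_term; ring.
have ba m x : `|b m x| <= a m by exact: pqa.
rewrite (@eq_Rintegral _ _ _ _ _ (fun x => usum (b ^~ x))); last first.
  move=> x _; symmetry; apply: (@usum_lin _ _ a a0 sa (re_term ^~ x) (im_term ^~ x)) => //.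
  - by move=> i; exact: re_term_le.
  - by move=> i; exact: im_term_le.
  - exact: cos_max.
  - exact: sin_max.
have bk m : \int[mu]_(x in D) b m x =
    if m == k then (p k * cos th + q k * sin th) * s ^+ n else 0.
  have -> : \int[mu]_(x in D) b m x = if m - k == 0
      then (p m * cos (- th) - q m * sin (- th)) * s ^+ n else 0.
    have ic t := integrable_cos_phase w (m - k) t (ltW s0).
    have mD := @measurable_cube R n s.
    rewrite (@eq_Rintegral _ _ _ _ _ (fun x => p m * cos (phase w (m - k) x + - th) -
       q m * cos (phase w (m - k) x + (- th - pi / 2)))); last first.
      by move=> x _; rewrite addrA cosBpihalf.
    rewrite RintegralB ?RintegralZl ?Rintegral_cos_phase//.
    - by case: eqP => // _; rewrite ?cosBpihalf ?mulr0 ?subr0//; ring.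
    - by have := integrableZl mD (p m) (ic (- th)).
    - by have := integrableZl mD (q m) (ic (- th - pi / 2)).
  by rewrite subr_eq0; case: eqP => // ->; rewrite cosN sinN mulrN opprK.
rewrite (Rintegral_usum (k := k) (ltW s0) a0 sa ba) ?bk ?eqxx//.
- move=> m; rewrite (_ : b m = fun x => re_term m x * cos (phase w k x + th) +
      im_term m x * cos (phase w k x + (th - pi / 2))).
    apply: measurable_funD; apply: measurable_funM.
    + exact: measurable_re_term.
    + exact: measurable_cos_phase.
    + exact: measurable_im_term.
    + exact: measurable_cos_phase.
  by apply/funext => x; rewrite bE addrA cosBpihalf.
- by move=> m mk; rewrite bk (negbTE mk).
Qed.

Variables (u v : 'rV[R]_n -> R).
Hypotheses (iu : mu.-integrable D (EFin \o u)) (iv : mu.-integrable D (EFin \o v)).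
Hypothesis coef : forall k th,
  \int[mu]_(x in D) (u x * cos (phase w k x + th) + v x * sin (phase w k x + th)) =
  (p k * cos th + q k * sin th) * s ^+ n.

(** The difference of [u + i v] and of the series is orthogonal to all
    characters; so are its real and imaginary parts, as follows by comparing the
    frequencies [k] and [- k]. *)
Theorem fourier_inversion :
  {ae mu, forall x, D x -> u x = re_series x /\ v x = im_series x}.
Proof.
have mD := @measurable_cube R n s; have s0' := ltW s0.
have [M hM] := usum_bounded a0 sa.
have ire : mu.-integrable D (EFin \o re_series).
  apply: (bounded_integrable (M := M)) => //.
    by apply: measurable_funTS; exact: measurable_re_series.
  by move=> x _; apply: hM => i; exact: re_term_le.
have iim : mu.-integrable D (EFin \o im_series).
  apply: (bounded_integrable (M := M)) => //.
    by apply: measurable_funTS; exact: measurable_im_series.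
  by move=> x _; apply: hM => i; exact: im_term_le.
pose du x := u x - re_series x; pose dv x := v x - im_series x.
have idu : mu.-integrable D (EFin \o du) by have := integrableB mD iu ire.
have idv : mu.-integrable D (EFin \o dv) by have := integrableB mD iv iim.
have ics f g k th : mu.-integrable D (EFin \o f) -> mu.-integrable D (EFin \o g) ->
    mu.-integrable D (EFin \o
      (fun x => f x * cos (phase w k x + th) + g x * sin (phase w k x + th))).
  move=> if_ ig.
  by have := integrableD mD (integrableM_cos w k th if_) (integrableM_sin w k th ig).
have d0 k th : \int[mu]_(x in D) (du x * cos (phase w k x + th) +
    dv x * sin (phase w k x + th)) = 0.
  rewrite (@eq_Rintegral _ _ _ _ _ (fun x =>
    (u x * cos (phase w k x + th) + v x * sin (phase w k x + th)) -
    (re_series x * cos (phase w k x + th) + im_series x * sin (phase w k x + th)))).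
    rewrite RintegralB ?coef ?series_coef ?subrr//; exact: ics.
  by move=> x _; rewrite /du /dv; ring.
(* replacing k and th by their opposites changes the sign of the sine only *)
have split k th : \int[mu]_(x in D) (du x * cos (phase w k x + th)) = 0 /\
    \int[mu]_(x in D) (dv x * sin (phase w k x + th)) = 0.
  have := d0 k th; have := d0 (- k) (- th).
  rewrite (@eq_Rintegral _ _ _ _ _ (fun x =>
    du x * cos (phase w k x + th) - dv x * sin (phase w k x + th))); last first.
    by move=> x _; rewrite phaseN -opprD cosN sinN mulrN.
  rewrite (RintegralB mD (integrableM_cos w k th idu) (integrableM_sin w k th idv)).
  rewrite (RintegralD mD (integrableM_cos w k th idu) (integrableM_sin w k th idv)).
  by move=> h1 h2; split; lra.
have hu := trig_orth_ae0 s0 ws idu (fun m th => (split m th).1).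
have hv : {ae mu, forall x, D x -> dv x = 0}.
  apply: (trig_orth_ae0 s0 ws idv) => m th.
  have [_] := split m (th + pi / 2).
  by under eq_Rintegral do rewrite addrA sinDpihalf.
apply: filterS2 hu hv => x h1 h2 Dx; split; apply/eqP; rewrite -subr_eq0; apply/eqP.
  exact: h1.
exact: h2.
Qed.

End inversion.

(** * Integrals of functions that agree almost everywhere *)

Section ae_equal_integrals.
Import HBNNSimple.
Context d (T : measurableType d) (R : realType) (mu : {measure set T -> \bar R}).
Implicit Types (D : set T).
Local Open Scope ereal_scope.

(** This covers functions that may fail to be measurable, because the integral of
    a nonnegative function is the supremum over the simple functions below it,
    and a simple function can be set to zero on a null set without changing its
    integral. *)
Lemma ge0_le_integral_ae D (f g : T -> \bar R) :
  (forall x, D x -> 0 <= f x) -> (forall x, D x -> 0 <= g x) ->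
  {ae mu, forall x, D x -> f x = g x} ->
  \int[mu]_(x in D) f x <= \int[mu]_(x in D) g x.
Proof.
move=> f0 g0 [N [mN N0 fgN]]; rewrite !ge0_integralE//.
apply: ge_ereal_sup => _ [h /= hf <-].
have mNC := measurableC mN; pose h' := proj_nnsfun h mNC.
have <- : sintegral mu h' = sintegral mu h.
  rewrite -!integralT_nnsfun; apply: ae_eq_integral => //.
  - exact/measurable_EFinP.
  - exact/measurable_EFinP.
  - exists N; split => // x /= hx; apply: contrapT => nx; apply: hx => _.
    transitivity ((h x * \1_(~` N) x)%:E); first by [].
    by rewrite indicE mem_set// mulr1.
apply: ereal_sup_ubound; exists h' => // x.
change ((h x * \1_(~` N) x)%:E <= (g \_ D) x).
rewrite indicE patchE; have [xN|xN] := pselect (N x).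
  rewrite memNset ?mulr0; last by move=> /(_ xN).
  by case: ifPn => // /set_mem; exact: g0.
rewrite mem_set// mulr1; apply: le_trans (hf x) _; rewrite patchE.
case: ifPn => // /set_mem Dx; rewrite le_eqVlt; apply/orP; left; apply/eqP.
by apply: contrapT => fgx; apply: xN; apply: fgN => /= /(_ Dx).
Qed.

Lemma eq_integral_ae D (f g : T -> \bar R) :
  {ae mu, forall x, D x -> f x = g x} ->
  \int[mu]_(x in D) f x = \int[mu]_(x in D) g x.
Proof.
have key (f' g' : T -> \bar R) : (forall x, D x -> 0 <= f' x) -> (forall x, D x -> 0 <= g' x) ->
    {ae mu, forall x, D x -> f' x = g' x} ->
    \int[mu]_(x in D) f' x = \int[mu]_(x in D) g' x.
  move=> f0 g0 fg; apply/eqP; rewrite eq_le !ge0_le_integral_ae//.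
  by apply: filterS fg => x h Dx; rewrite h.
move=> fg; rewrite integralE [RHS]integralE; congr (_ - _); apply: key => //.
- by apply: filterS fg => x h Dx; rewrite unlock /= h.
- by apply: filterS fg => x h Dx; rewrite unlock /= h.
Qed.

Lemma eq_Rintegral_ae D (f g : T -> R) :
  {ae mu, forall x, D x -> f x = g x} ->
  (\int[mu]_(x in D) f x = \int[mu]_(x in D) g x)%R.
Proof.
move=> fg; rewrite /Rintegral; congr fine; apply: eq_integral_ae.
by apply: filterS fg => x h Dx; rewrite h.
Qed.

End ae_equal_integrals.

(** * Exponentials and norms of complex numbers *)

Section complex_aux.
Context {R : realType}.
Local Open Scope complex_scope.
Implicit Types (z : R[i]) (t : R).

Lemma expiD t t' : expi (t + t') = expi t * expi t' :> R[i].
Proof. by rewrite /expi cosD sinD; simpc; rewrite [X in _ +i* X]addrC. Qed.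

Lemma expi0 : expi 0 = 1 :> R[i].
Proof. by rewrite /expi cos0 sin0. Qed.

Lemma normc_expi t : Normc.normc (expi t : R[i]) = 1.
Proof. by rewrite /expi /= cos2Dsin2 sqrtr1. Qed.

Lemma normr_Re_le z : `|complex.Re z| <= Normc.normc z.
Proof.
by case: z => x y /=; rewrite -sqrtr_sqr ler_wsqrtr// lerDl sqr_ge0.
Qed.

Lemma normr_Im_le z : `|complex.Im z| <= Normc.normc z.
Proof.
by case: z => x y /=; rewrite -sqrtr_sqr ler_wsqrtr// lerDr sqr_ge0.
Qed.

Lemma normc_le_ReIm z : Normc.normc z <= `|complex.Re z| + `|complex.Im z|.
Proof.
case: z => x y /=; rewrite -[leRHS]ger0_norm ?addr_ge0// -sqrtr_sqr.
apply: ler_wsqrtr; rewrite sqrrD !real_normK ?num_real//.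
have : 0 <= `|x| * `|y| by rewrite mulr_ge0.
by lra.
Qed.

Lemma normc_ge0 z : 0 <= Normc.normc z.
Proof. by case: z => x y /=; exact: sqrtr_ge0. Qed.

Lemma normcX z n : Normc.normc (z ^+ n) = Normc.normc z ^+ n.
Proof.
by elim: n => [|n IH]; rewrite ?expr0 ?Normc.normc1// !exprS Normc.normcM IH.
Qed.

Lemma sin_eq0_int t : sin t = 0 -> exists k : int, t = k%:~R * pi.
Proof.
move=> t0; pose k := Num.floor (t / pi); exists k.
have p0 := pi_gt0 R.
have /andP[k1 k2] : k%:~R <= t / pi < (k + 1)%:~R.
  by rewrite Num.Theory.floor_le Num.Theory.floorD1_gt.
have h1 : 0 <= t - k%:~R * pi by rewrite subr_ge0 -ler_pdivlMr.
have h2 : t - k%:~R * pi < pi.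
  by move: k2; rewrite ltr_pdivrMr// intrD mulrDl mul1r; lra.
have s0 : sin (t - k%:~R * pi) = 0 by rewrite sinB t0 sin_int_pi mul0r mulr0 subrr.
move: h1; rewrite le_eqVlt => /orP[/eqP h|h1]; first by apply/eqP; rewrite -subr_eq0 -h.
by have := @sin_gt0_pi R (t - k%:~R * pi); rewrite s0 ltxx h1 h2 => /(_ isT).
Qed.

End complex_aux.

(** * Continuous functions on the torus *)

Section continuity.
Context {R : realType}.

Lemma continuous_big (T : topologicalType) (I : Type) (l : seq I) (b : I -> T -> R) :
  (forall i, continuous (b i)) -> continuous (fun x => \sum_(i <- l) b i x).
Proof.
move=> cb x; elim: l => [|i l IH].
  rewrite (_ : (fun x => _) = cst 0); first exact: cvg_cst.
  by apply/funext => y; rewrite big_nil.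
rewrite (_ : (fun x => _) = (fun x => b i x + \sum_(j <- l) b j x)).
  by apply: cvgD => //; exact: cb.
by apply/funext => y; rewrite big_cons.
Qed.

Lemma continuous_usum (T : topologicalType) (I : choiceType) (a : I -> R) (b : I -> T -> R) :
  (forall i, 0 <= a i) -> (\esum_(i in [set: I]) (a i)%:E < +oo)%E ->
  (forall i x, `|b i x| <= a i) -> (forall i, continuous (b i)) ->
  continuous (fun x => usum (b ^~ x)).
Proof.
move=> a0 sa ba cb x; apply/cvgrPdist_le => e e0.
have e3 : 0 < e / 3 by rewrite divr_gt0.
have [A hA] := usum_unif a0 sa e3.
have hAx y : `|usum (b ^~ y) - \sum_(i <- A) b i y| <= e / 3.
  by apply: hA => // i; exact: ba.
have := @continuous_big _ _ (enum_fset A) b cb x.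
move=> /cvgrPdist_le/(_ _ e3); apply: filterS => y h.
move: (hAx x) (hAx y) h => /ler_normlP[h1 h2] /ler_normlP[h3 h4] /ler_normlP[h5 h6].
by rewrite ler_norml; apply/andP; split; lra.
Qed.

Lemma continuous_scale (T : topologicalType) (c : R) (f : T -> R) :
  continuous f -> continuous (fun x => c * f x).
Proof. by move=> cf x; apply: continuousM; [exact: cst_continuous|exact: cf]. Qed.

Lemma cvg_complex (T : Type) (F : set_system T) {FF : Filter F} (U V : T -> R) (x y : R) :
  U @ F --> x -> V @ F --> y ->
  ((fun t => Complex (U t) (V t)) : T -> R[i]^o) @ F --> (Complex x y : R[i]^o).
Proof.
move=> cU cV; apply/cvgrPdist_lt => -[e e'].
rewrite ltcE/= => /andP[/eqP e'0 e0]; rewrite e'0.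
have e2 : 0 < e / 3 by rewrite divr_gt0.
move/cvgrPdist_lt/(_ _ e2) : cU => cU; move/cvgrPdist_lt/(_ _ e2) : cV => cV.
apply: filterS2 cU cV => t h1 h2.
rewrite normc_def ltcE/= eqxx/=.
apply: (le_lt_trans (normc_le_ReIm (Complex (x - U t) (y - V t)))) => /=.
by lra.
Qed.

(** Near [t], the value at [x] is compared with [acos (cos t) - e] and
    [acos (cos t) + e] through their cosines, by monotonicity on [0, pi]; this
    also covers the multiples of [pi], where [acos] is not differentiable at
    [cos t]. *)
Lemma continuous_acos_cos : continuous (fun t : R => acos (cos t)).
Proof.
have cb (t : R) : -1 <= cos t <= 1 by rewrite cos_geN1 cos_le1.
have I (t : R) : acos (cos t) \in `[0, pi].
  by rewrite in_itv/= acos_ge0// acos_lepi.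
have K (t : R) : cos (acos (cos t)) = cos t.
  by rewrite acosK// in_itv/=.
move=> t; apply/cvgrPdist_lt => e e0.
have lo : \forall x \near t, acos (cos t) - e < acos (cos x).
  have [h|h] := ltP (acos (cos t) - e) 0.
    by near=> x; apply: (lt_le_trans h); rewrite acos_ge0.
  have Ie : acos (cos t) - e \in `[0, pi].
    by have := I t; rewrite !in_itv/= => /andP[h1 h2]; apply/andP; split; lra.
  have : cos t < cos (acos (cos t) - e).
    by rewrite -[X in X < _]K ltr_cos//; lra.
  move=> h'; near=> x; rewrite -ltr_cos// K; near: x.
  exact: (cvgr_lt (cos t) (@continuous_cos R t) _ h').
have hi : \forall x \near t, acos (cos x) < acos (cos t) + e.
  have [h|h] := ltP pi (acos (cos t) + e).
    by near=> x; apply: le_lt_trans h; rewrite acos_lepi.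
  have Ie : acos (cos t) + e \in `[0, pi].
    by have := I t; rewrite !in_itv/= => /andP[h1 h2]; apply/andP; split; lra.
  have : cos (acos (cos t) + e) < cos t.
    by rewrite -[X in _ < X]K ltr_cos//; lra.
  move=> h'; near=> x; rewrite -ltr_cos// K; near: x.
  exact: (cvgr_gt (cos t) (@continuous_cos R t) _ h').
near=> x.
have h1 : acos (cos t) - e < acos (cos x) by near: x.
have h2 : acos (cos x) < acos (cos t) + e by near: x.
rewrite ltr_norml; apply/andP; split; lra.
Unshelve. all: by end_near. Qed.

Lemma cos_periodZ (t : R) (k : int) : cos (t + 2 * (k%:~R * pi)) = cos t.
Proof.
have h : sin (k%:~R * pi) = 0 :> R by exact: sin_int_pi.
have c2 : cos (k%:~R * pi) ^+ 2 = 1 :> R by rewrite cos2sin2 h expr0n/= subr0.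
rewrite (_ : t + _ = t + k%:~R * pi + k%:~R * pi); last ring.
by rewrite cosD [cos (t + _)]cosD h !mulr0 !subr0 -mulrA -expr2 c2 mulr1.
Qed.

Lemma sin_periodZ (t : R) (k : int) : sin (t + 2 * (k%:~R * pi)) = sin t.
Proof. by rewrite -!cosBpihalf addrAC cos_periodZ. Qed.

(** The square of the distance from [t] to the multiples of [s]. *)
Definition fold_sq (s t : R) : R := (acos (cos (2 * pi * t / s)) * (s / (2 * pi))) ^+ 2.

Lemma fold_sqE s t : 0 < s -> - (s / 2) <= t <= s / 2 -> fold_sq s t = t ^+ 2.
Proof.
move=> s0 /andP[t1 t2]; have p0 := pi_gt0 R.
have -> : fold_sq s t = (`|2 * pi * t / s| * (s / (2 * pi))) ^+ 2.
  rewrite /fold_sq -[in LHS]cos_norm cosK// in_itv/= normr_ge0/=.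
  have e : 2 * pi * t / s = pi * (2 * t / s) by ring.
  rewrite e normrM gtr0_norm// -[leRHS]mulr1 ler_pM2l// ler_norml.
  by rewrite ler_pdivlMr// ler_pdivrMr//; apply/andP; split; lra.
rewrite exprMn real_normK ?num_real// -exprMn; congr (_ ^+ 2).
by move: p0; generalize (pi : R) => P P0; field; rewrite !gt_eqF.
Qed.

Lemma fold_sq_period s t : 0 < s -> fold_sq s (t + s) = fold_sq s t.
Proof.
move=> s0; rewrite /fold_sq; congr ((acos _ * _) ^+ 2).
rewrite -[RHS](cos_periodZ _ 1); congr cos; field.
by rewrite gt_eqF.
Qed.

Lemma continuous_fold_sq s : continuous (fold_sq s).
Proof.
have c : continuous (fun t : R => acos (cos (2 * pi * t / s)) * (s / (2 * pi))).
  move=> t; apply: cvgM; last exact: cvg_cst.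
  apply: (continuous_comp (f := fun t => 2 * pi * t / s) (g := fun t => acos (cos t))).
    apply: cvgM; last exact: cvg_cst.
    by apply: cvgM; [exact: cvg_cst|exact: cvg_id].
  exact: continuous_acos_cos.
by move=> t; apply: cvgM; exact: c.
Qed.

End continuity.

Section torus_continuity.
Context {R : realType} (n : nat).
Variables (s w : R).
Hypothesis ws : `|w| * s = 1.
Variables (p q a : 'rV[int]_n -> R).
Hypotheses (a0 : forall m, 0 <= a m)
  (sa : (\esum_(m in [set: 'rV[int]_n]) (a m)%:E < +oo)%E)
  (pqa : forall m th, `|p m * cos th - q m * sin th| <= a m).

Lemma continuous_phase m : continuous (@phase R n w m).
Proof.
rewrite (_ : phase w m = dotp ((2 * pi * w) *: int_rV m)).
  apply: continuous_big => i x; apply: continuousM; first exact: cst_continuous.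
  exact: coord_continuous.
by apply/funext => x; exact: phase_dotp.
Qed.

Lemma continuous_trig_phase (f : R -> R) m : continuous f ->
  continuous (fun x => f (@phase R n w m x)).
Proof.
move=> cf x; apply: continuous_comp; first exact: continuous_phase.
exact: cf.
Qed.

Lemma continuous_scaled_trig (f : R -> R) (c : R) m : continuous f ->
  continuous (fun x : 'rV[R]_n => c * f (phase w m x)).
Proof.
move=> cf x; apply: continuousM; first exact: cst_continuous.
exact: continuous_trig_phase.
Qed.

Lemma continuous_re_series : continuous (@re_series R n w p q).
Proof.
apply: (continuous_usum a0 sa) => [m x|m x]; first exact: re_term_le.
have c1 := @continuous_scaled_trig cos (p m) m (@continuous_cos R) x.
have c2 := @continuous_scaled_trig sin (q m) m (@continuous_sin R) x.
exact: (cvgB c1 c2).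
Qed.

Lemma continuous_im_series : continuous (@im_series R n w p q).
Proof.
apply: (continuous_usum a0 sa) => [m x|m x]; first exact: im_term_le.
have c1 := @continuous_scaled_trig cos (q m) m (@continuous_cos R) x.
have c2 := @continuous_scaled_trig sin (p m) m (@continuous_sin R) x.
exact: (cvgD c1 c2).
Qed.

Lemma phase_shift m i (x : 'rV[R]_n) : exists k : int,
  phase w m (x + s *: delta_mx ord0 i) = phase w m x + 2 * (k%:~R * pi).
Proof.
have e : phase w m (x + s *: delta_mx ord0 i) =
    phase w m x + 2 * (w * s * (m ord0 i)%:~R * pi).
  rewrite /phase (_ : dotp _ _ = dotp (int_rV m) x + (m ord0 i)%:~R * s); first ring.
  rewrite /dotp (bigD1 i)// [in RHS](bigD1 i)//= !mxE !eqxx mulr1.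
  rewrite (eq_bigr (fun j => int_rV m ord0 j * x ord0 j)); first ring.
  by move=> j ji; rewrite !mxE eqxx (negbTE ji) mulr0 addr0.
have [wp|wn] := leP 0 w.
  by exists (m ord0 i); rewrite e -(ger0_norm wp) ws mul1r.
exists (- m ord0 i); rewrite e.
have -> : w * s = -1 by move: ws; rewrite ltr0_norm// mulNr => <-; rewrite opprK.
by rewrite intrN mulN1r.
Qed.

Lemma series_period i (x : 'rV[R]_n) :
  re_series w p q (x + s *: delta_mx ord0 i) = re_series w p q x /\
  im_series w p q (x + s *: delta_mx ord0 i) = im_series w p q x.
Proof.
split; congr usum; apply/funext => m; rewrite /re_term /im_term;
  by have [k ->] := phase_shift m i x; rewrite cos_periodZ sin_periodZ.
Qed.

End torus_continuity.

Section torus_chirp.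
Context {R : realType} (n : nat).
Variables (s c : R).
Hypothesis s0 : 0 < s.

(** A continuous and periodic function, equal to the exponent of the chirp on the
    cube. *)
Definition torus_chirp_angle (x : 'rV[R]_n) : R :=
  pi * (\sum_i fold_sq s (x ord0 i)) * c.

Lemma torus_chirp_angleE x : cube s x ->
  torus_chirp_angle x = pi * dotp x x * c.
Proof.
move=> Dx; congr (_ * _ * _); apply: eq_bigr => i _.
by rewrite fold_sqE// ?expr2//; exact: Dx.
Qed.

Lemma torus_chirp_angle_period x i :
  torus_chirp_angle (x + s *: delta_mx ord0 i) = torus_chirp_angle x.
Proof.
congr (_ * _ * _); apply: eq_bigr => j _; rewrite !mxE eqxx/=.
by case: eqP => [->|_]; rewrite ?mulr1 ?fold_sq_period ?mulr0 ?addr0.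
Qed.

Lemma continuous_torus_chirp_angle : continuous torus_chirp_angle.
Proof.
have cs : continuous (fun x : 'rV[R]_n => \sum_i fold_sq s (x ord0 i)).
  apply: continuous_big => i x.
  apply: (continuous_comp (f := fun x : 'rV[R]_n => x ord0 i) (g := fold_sq s)).
    exact: coord_continuous.
  exact: continuous_fold_sq.
have := @continuous_scale R _ c _ (@continuous_scale R _ pi _ cs).
rewrite (_ : (fun x => _) = torus_chirp_angle)//.
by apply/funext => x; rewrite /torus_chirp_angle mulrC.
Qed.

End torus_chirp.

(** * Fractional Fourier coefficients as ordinary ones *)

Section complex_calculus.
Context {R : realType}.
Local Open Scope complex_scope.

Lemma sum_complex (I : Type) (l : seq I) (b c : I -> R) :
  \sum_(i <- l) (b i +i* c i) = (\sum_(i <- l) b i) +i* (\sum_(i <- l) c i).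
Proof.
elim: l => [|i l IH]; first by rewrite !big_nil.
by rewrite !big_cons IH.
Qed.

Lemma Re_mul (z z' : R[i]) : complex.Re (z * z') =
  complex.Re z * complex.Re z' - complex.Im z * complex.Im z'.
Proof. by case: z z' => ? ? []. Qed.

Lemma Im_mul (z z' : R[i]) : complex.Im (z * z') =
  complex.Re z * complex.Im z' + complex.Im z * complex.Re z'.
Proof. by case: z z' => ? ? []. Qed.

Lemma complex_eta (z : R[i]) : z = complex.Re z +i* complex.Im z.
Proof. by case: z. Qed.

Lemma csums_to_scaled (I : choiceType) (a b b' : I -> R) (c : R[i]) :
  (forall i, 0 <= a i) -> (\esum_(i in [set: I]) (a i)%:E < +oo)%E ->
  (forall i, `|b i| <= a i) -> (forall i, `|b' i| <= a i) ->
  csums_to (fun i => c * (b i +i* b' i)) (c * (usum b +i* usum b')).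
Proof.
move=> a0 sa ba b'a; rewrite /csums_to.
rewrite (_ : partial_sum _ = fun A : {fset I} => Complex
    (complex.Re c * (\sum_(i <- A) b i) - complex.Im c * (\sum_(i <- A) b' i))
    (complex.Re c * (\sum_(i <- A) b' i) + complex.Im c * (\sum_(i <- A) b i))).
  rewrite [X in _ --> X]complex_eta Re_mul Im_mul /=.
  have cb := usum_cvg a0 sa ba; have cb' := usum_cvg a0 sa b'a.
  by apply: cvg_complex; [apply: cvgB|apply: cvgD]; apply: cvgM => //;
    exact: cvg_cst.
apply/funext => A; rewrite partial_sumE -mulr_sumr sum_complex.
by rewrite [LHS]complex_eta Re_mul Im_mul.
Qed.

Lemma continuous_expi_mul (T : topologicalType) (ph U V : T -> R) :
  continuous ph -> continuous U -> continuous V ->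
  continuous ((fun x => expi (ph x) * (U x +i* V x)) : T -> R[i]^o).
Proof.
move=> cph cU cV x.
have cc : {for x, continuous (fun x => cos (ph x))}.
  by apply: continuous_comp; [exact: cph|exact: continuous_cos].
have cs : {for x, continuous (fun x => sin (ph x))}.
  by apply: continuous_comp; [exact: cph|exact: continuous_sin].
exact: (cvg_complex (cvgB (cvgM cc (cU x)) (cvgM cs (cV x)))
                    (cvgD (cvgM cc (cV x)) (cvgM cs (cU x)))).
Qed.

End complex_calculus.

Section fractional_kernel.
Context {R : realType} (n : nat).
Local Open Scope complex_scope.
Implicit Types (alpha : R) (m : 'rV[int]_n) (x : 'rV[R]_n).

Lemma cotN alpha : cot (- alpha) = - cot alpha.
Proof. by rewrite /cot cosN sinN invrN mulrN. Qed.

Lemma cscN alpha : csc (- alpha) = - csc alpha.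
Proof. by rewrite /csc sinN invrN. Qed.

Lemma chirpN alpha x : chirp (- alpha) x * chirp alpha x = 1.
Proof. by rewrite /chirp -expiD cotN mulrN addNr expi0. Qed.

Lemma frac_charE alpha m x :
  frac_char alpha (int_rV m) x = expi (- phase (csc alpha) m x).
Proof. by []. Qed.

Lemma frac_charN alpha m x :
  frac_char (- alpha) (int_rV m) x = expi (phase (csc alpha) m x).
Proof. by rewrite /frac_char cscN mulrN opprK. Qed.

(** The two square roots are conjugate, since their arguments are; hence their
    product is the modulus of [1 - i cot alpha], which is [|csc alpha|]. *)
Lemma frac_amp_mul alpha : sin alpha != 0 ->
  frac_amp alpha * frac_amp (- alpha) = `|csc alpha|%:C.
Proof.
move=> sa0; rewrite /frac_amp cotN opprK; set c := cot alpha.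
have rE : Num.sqrt (1 ^+ 2 + c ^+ 2) = `|csc alpha|.
  rewrite -sqrtr_sqr; congr Num.sqrt; rewrite /c /cot /csc.
  transitivity ((cos alpha ^+ 2 + sin alpha ^+ 2) / sin alpha ^+ 2).
    by field.
  by rewrite cos2Dsin2 div1r exprVn.
rewrite /sqrtc sqrrN rE; set r := `|csc alpha|.
have r1 : 1 <= r.
  by rewrite /r -rE -[leLHS]sqrtr1 ler_wsqrtr// expr1n lerDl sqr_ge0.
(* sqrtc gives a real argument a sign of its own, whence the case cot = 0 *)
rewrite oppr_eq0; case: eqP => [c0|/eqP c0].
  have r1' : r = 1 by rewrite /r -rE c0 expr0n/= addr0 expr1n sqrtr1.
  rewrite r1' subrr mul0r sqrtr0 mulr0; simpc.
  have -> : (1 + 1) / 2 = 1 :> R by field.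
  by rewrite sqrtr1 mulr1.
have sq : Num.sg c ^+ 2 = 1 by rewrite sqr_sg c0.
rewrite sgrN; simpc; congr (_ +i* _); last by ring.
set X := Num.sqrt ((r + 1) / 2); set Y := Num.sqrt ((r - 1) / 2).
have X2 : X ^+ 2 = (r + 1) / 2 by rewrite sqr_sqrtr//; lra.
have Y2 : Y ^+ 2 = (r - 1) / 2 by rewrite sqr_sqrtr//; lra.
transitivity (X ^+ 2 + Num.sg c ^+ 2 * Y ^+ 2); first by ring.
by rewrite sq X2 Y2; field.
Qed.

(** The chirps in the index [m] cancel between the coefficient and the kernel,
    so only the chirp in [x] survives in a term of the inversion series. *)
Lemma frac_kernel_term alpha m x (z : R[i]) : sin alpha != 0 ->
  frac_amp alpha ^+ n * chirp alpha (int_rV m) * z *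
    frac_kernel (- alpha) m x =
  chirp (- alpha) x *
    (`|csc alpha|%:C ^+ n * (z * expi (phase (csc alpha) m x))).
Proof.
move=> sa0; rewrite /frac_kernel frac_charN -(frac_amp_mul sa0) exprMn.
transitivity ((chirp (- alpha) (int_rV m) * chirp alpha (int_rV m)) *
  (chirp (- alpha) x * (frac_amp alpha ^+ n * frac_amp (- alpha) ^+ n *
    (z * expi (phase (csc alpha) m x))))); first by ring.
by rewrite chirpN mul1r.
Qed.

End fractional_kernel.

Section fractional_coefficients.
Context {R : realType} (n : nat).
Variables (alpha : R) (f g g0 : 'rV[R]_n -> R[i]).
Local Open Scope complex_scope.
Local Notation mu := (@lebesgue_rV R n).
Local Notation D := (@cube R n `|sin alpha|).
Local Notation phi := (phase (csc alpha)).

Lemma integrable_ReIm : measurable_fun D (fun x => complex.Re (g0 x)) ->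
  measurable_fun D (fun x => complex.Im (g0 x)) ->
  (\int[mu]_(x in D) (Normc.normc (g0 x))%:E < +oo)%E ->
  mu.-integrable D (EFin \o (fun x => complex.Re (g0 x))) /\
  mu.-integrable D (EFin \o (fun x => complex.Im (g0 x))).
Proof.
move=> mre mim foo; have mD := @measurable_cube R n `|sin alpha|.
have mn : measurable_fun D (fun x => (Normc.normc (g0 x))%:E).
  apply/measurable_EFinP.
  rewrite (_ : (fun x => _) = (fun x =>
    Num.sqrt (complex.Re (g0 x) ^+ 2 + complex.Im (g0 x) ^+ 2))); last first.
    by apply/funext => x; case: (g0 x).
  apply: (measurableT_comp (continuous_measurable_fun (@sqrt_continuous R))).
  by apply: measurable_funD; apply: measurable_funX.
split; apply/integrableP; (split; first exact/measurable_EFinP);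
  apply: le_lt_trans foo; apply: ge0_le_integral => //.
- exact/measurable_EFinP/measurableT_comp.
- by move=> x _; rewrite lee_fin normr_Re_le.
- exact/measurable_EFinP/measurableT_comp.
- by move=> x _; rewrite lee_fin normr_Im_le.
Qed.

Hypotheses
  (iu : mu.-integrable D (EFin \o (fun x => complex.Re (g0 x))))
  (iv : mu.-integrable D (EFin \o (fun x => complex.Im (g0 x)))).

Definition twist_re m th x : R := complex.Re (g0 x) * cos (phi m x + th) +
                                  complex.Im (g0 x) * sin (phi m x + th).
Definition twist_im m th x : R := complex.Im (g0 x) * cos (phi m x + th) -
                                  complex.Re (g0 x) * sin (phi m x + th).

Lemma twistE m th x :
  twist_re m th x +i* twist_im m th x = g0 x * expi (- (phi m x + th)).
Proof.
rewrite [g0 x]complex_eta /expi /twist_re /twist_im cosN sinN.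
by simpc; congr Complex; ring.
Qed.

Lemma integrable_twist_re m th : mu.-integrable D (EFin \o twist_re m th).
Proof.
exact: (integrableD (@measurable_cube R n `|sin alpha|) (integrableM_cos (csc alpha) m th iu)
  (integrableM_sin (csc alpha) m th iv)).
Qed.

Lemma integrable_twist_im m th : mu.-integrable D (EFin \o twist_im m th).
Proof.
exact: (integrableB (@measurable_cube R n `|sin alpha|) (integrableM_cos (csc alpha) m th iv)
  (integrableM_sin (csc alpha) m th iu)).
Qed.

Definition fourier_re m : R := \int[mu]_(x in D) twist_re m 0 x.
Definition fourier_im m : R := \int[mu]_(x in D) twist_im m 0 x.

Let scaled_integrable (h : 'rV[R]_n -> R) (c : R) : mu.-integrable D (EFin \o h) ->
  mu.-integrable D (EFin \o (fun x => c * h x)).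
Proof. by move=> ih; have := integrableZl (@measurable_cube R n `|sin alpha|) c ih. Qed.

Lemma Rintegral_twist_re m th : \int[mu]_(x in D) twist_re m th x =
  fourier_re m * cos th + fourier_im m * sin th.
Proof.
have mD := @measurable_cube R n `|sin alpha|.
have ir := integrable_twist_re m 0; have ii := integrable_twist_im m 0.
rewrite mulrC [X in _ + X]mulrC -(RintegralZl _ mD ir) -(RintegralZl _ mD ii).
rewrite -(RintegralD mD (scaled_integrable _ ir) (scaled_integrable _ ii)).
apply: eq_Rintegral => x _; rewrite /twist_re /twist_im addr0 cosD sinD; ring.
Qed.

(** The chirp of the kernel undoes the chirp of [f = e_{-alpha} g], which
    leaves the usual Fourier integral of [g]. *)
Lemma frac_fourierE m : g = g0 %[ae mu in D] ->
  (forall x, D x -> f x = chirp (- alpha) x * g x) ->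
  frac_fourier alpha f m = frac_amp alpha ^+ n * chirp alpha (int_rV m) *
    (fourier_re m +i* fourier_im m).
Proof.
move=> gg0 fg; set kap := _ ^+ n * _.
have mD := @measurable_cube R n `|sin alpha|.
have ir := integrable_twist_re m 0; have ii := integrable_twist_im m 0.
have fE : {ae mu, forall x, D x -> f x * frac_kernel alpha m x =
    kap * (twist_re m 0 x +i* twist_im m 0 x)}.
  apply: filterS gg0 => x /[swap] Dx /(_ Dx) gx.
  rewrite twistE addr0 (fg x Dx) gx /frac_kernel frac_charE /kap.
  transitivity ((chirp (- alpha) x * chirp alpha x) *
     (frac_amp alpha ^+ n * chirp alpha (int_rV m) * (g0 x * expi (- phi m x)))).
    by ring.
  by rewrite chirpN mul1r.
rewrite /frac_fourier /cintegral [RHS]complex_eta (Re_mul kap) (Im_mul kap); congr Complex.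
- rewrite (@eq_Rintegral_ae _ _ _ mu D _ (fun x =>
    complex.Re kap * twist_re m 0 x - complex.Im kap * twist_im m 0 x)).
    rewrite (RintegralB mD (scaled_integrable _ ir) (scaled_integrable _ ii)).
    by rewrite (RintegralZl _ mD ir) (RintegralZl _ mD ii).
  by apply: filterS fE => x h Dx; rewrite h// Re_mul.
- rewrite (@eq_Rintegral_ae _ _ _ mu D _ (fun x =>
    complex.Re kap * twist_im m 0 x + complex.Im kap * twist_re m 0 x)).
    rewrite (RintegralD mD (scaled_integrable _ ii) (scaled_integrable _ ir)).
    by rewrite (RintegralZl _ mD ir) (RintegralZl _ mD ii).
  by apply: filterS fE => x h Dx; rewrite h// Im_mul.
Qed.

End fractional_coefficients.

Theorem corollary3p3 (R : realType) (n : nat) (alpha : R)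
    (f : 'rV[R]_n -> R[i]) :
  (1 <= n)%N ->
  (forall k : int, alpha <> k%:~R * pi) ->
  chirp_L1 alpha f ->
  (\esum_(m in [set: 'rV[int]_n])
      (Normc.normc (frac_fourier alpha f m))%:E < +oo)%E ->
  (\forall x \ae lebesgue_rV n, frac_cube alpha x ->
     csums_to (fun m : 'rV[int]_n =>
                 frac_fourier alpha f m * frac_kernel (- alpha) m x) (f x)) /\
  (exists2 h : 'rV[R]_n -> R[i], continuous_torus alpha h &
     f = h %[ae lebesgue_rV n in frac_cube alpha]).
Proof.
move=> _ alphaN [g [g0 [mre mim foo gg0]] fg] sF.
have sin0 : sin alpha != 0.
  by apply/eqP => /sin_eq0_int[k]; exact: alphaN.
pose s := `|sin alpha|; pose w := csc alpha.
have s0 : 0 < s by rewrite normr_gt0.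
have ws : `|w| * s = 1 by rewrite /w /csc /s -normrM mulVf// normr1.
have [iu iv] := integrable_ReIm mre mim foo.
pose G m := Complex (fourier_re alpha g0 m) (fourier_im alpha g0 m).
have FE m : frac_fourier alpha f m =
    frac_amp alpha ^+ n * chirp alpha (int_rV m) * G m.
  exact: (frac_fourierE iu iv m gg0 fg).
(* the torus has volume s ^ n = |w| ^ (- n), so the coefficients of g on the
   characters are |w| ^ n * G *)
pose p m := `|w| ^+ n * fourier_re alpha g0 m.
pose q m := `|w| ^+ n * fourier_im alpha g0 m.
have amp0 : 0 < Normc.normc (frac_amp alpha).
  rewrite lt_neqAle normc_ge0 andbT eq_sym; apply/eqP => /Normc.eq0_normc h.
  have := frac_amp_mul sin0; rewrite h mul0r => -[] /esym/eqP.
  by rewrite normr_eq0 invr_eq0 (negbTE sin0).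
pose C := `|w| ^+ n / Normc.normc (frac_amp alpha) ^+ n.
pose a m := C * Normc.normc (frac_fourier alpha f m).
have C0 : 0 <= C by rewrite divr_ge0 ?exprn_ge0 ?normc_ge0.
have a0 m : 0 <= a m by rewrite mulr_ge0 ?normc_ge0.
have sa : (\esum_(m in [set: 'rV[int]_n]) (a m)%:E < +oo)%E.
  by apply: esum_scale_lty => // m; exact: normc_ge0.
have pqa m th : `|p m * cos th - q m * sin th| <= a m.
  have -> : p m * cos th - q m * sin th =
      `|w| ^+ n * complex.Re (G m * expi th).
    by rewrite Re_mul /= /p /q; ring.
  have -> : a m = `|w| ^+ n * Normc.normc (G m).
    rewrite /a FE !Normc.normcM normcX normc_expi mulr1 /C.
    by rewrite -mulrA mulKf// expf_neq0// gt_eqF.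
  rewrite normrM ger0_norm ?exprn_ge0//; apply: ler_wpM2l.
    exact: exprn_ge0.
  apply: (le_trans (normr_Re_le _)).
  by rewrite Normc.normcM normc_expi mulr1.
have coef k th : \int[@lebesgue_rV R n]_(x in cube s) twist_re alpha g0 k th x =
    (p k * cos th + q k * sin th) * s ^+ n.
  rewrite (Rintegral_twist_re iu iv) /p /q.
  have wsn : `|w| ^+ n * s ^+ n = 1 by rewrite -exprMn ws expr1n.
  by rewrite -!mulrA -mulrDr mulrAC wsn mul1r.
pose S x := Complex (re_series w p q x) (im_series w p q x).
have fS : {ae @lebesgue_rV R n, forall x, cube s x -> f x = chirp (- alpha) x * S x}.
  apply: filterS2 (fourier_inversion s0 ws a0 sa pqa iu iv coef) gg0.
  move=> x h1 h2 Dx; have [h3 h4] := h1 Dx; rewrite (fg x Dx) h2//.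
  by congr (_ * _); rewrite /S -h3 -h4 -complex_eta.
have termE m x : frac_fourier alpha f m * frac_kernel (- alpha) m x =
    chirp (- alpha) x * Complex (re_term w p q m x) (im_term w p q m x).
  rewrite FE (frac_kernel_term _ _ _ sin0); congr (_ * _).
  rewrite -rmorphXn /re_term /im_term /expi /p /q /G -/w; simpc.
  by congr Complex; ring.
split.
  apply: filterS fS => x fx Dx; rewrite fx//.
  rewrite (_ : (fun m => _) = (fun m => chirp (- alpha) x *
      Complex (re_term w p q m x) (im_term w p q m x))).
    apply: (@csums_to_scaled _ _ a (re_term w p q ^~ x) (im_term w p q ^~ x) _
      a0 sa) => m; [exact: re_term_le|exact: im_term_le].
  by apply/funext => m; exact: termE.
exists (fun x => expi (torus_chirp_angle s (cot (- alpha)) x) * S x).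
  split.
    apply: continuous_expi_mul; first exact: continuous_torus_chirp_angle.
      exact: (continuous_re_series a0 sa pqa).
    exact: (continuous_im_series a0 sa pqa).
  move=> x i; have [h1 h2] := series_period ws p q i x.
  by rewrite /S h1 h2 -/s torus_chirp_angle_period.
apply: filterS fS => x fx Dx.
by rewrite fx// /chirp torus_chirp_angleE.
Qed.
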